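(* Let $A$ be a unital $C^*$-algebra and let $\psi$ be a symmetric state on $\mathfrak A=\ast_{i=1}^\infty A$. There is a conditional expectation $G_\psi$ (i.e., a projection of norm $1$) from $\mathcal R_\psi$ onto $\mathcal F_\psi$ given by $$G_\psi(x)=\mathrm{WOT}\text{-}\lim_{n\to\infty}\alpha^n(x)\qquad(x\in\mathcal R_\psi),$$ where the limit is in the weak operator topology. It satisfies the following: (i) $\hat\psi\circ G_\psi=\hat\psi|_{\mathcal R_\psi}$; (ii) $G_\psi\circ\alpha=G_\psi$; (iii) for all $\sigma\in S_\infty$, $G_\psi\circ\hat\beta_\sigma|_{\mathcal R_\psi}=G_\psi$; (iv) the restriction $F_\psi$ of $G_\psi$ to $\mathcal Q_\psi$ is a conditional expectation from $\mathcal Q_\psi$ onto $\mathcal T_\psi$.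
   Context: $\mathfrak A=\ast_{i=1}^\infty A$ is the universal unital free product $C^*$-algebra of infinitely many copies of the unital $C^*$-algebra $A$, with canonical injective $*$-homomorphisms $\lambda_i:A\to\mathfrak A$ ($i\in\mathbf N$). A state $\psi$ on $\mathfrak A$ is symmetric if $\psi(\lambda_{i(1)}(a_1)\cdots\lambda_{i(n)}(a_n))=\psi(\lambda_{\sigma(i(1))}(a_1)\cdots\lambda_{\sigma(i(n))}(a_n))$ for all $n$, all $i(1),\dots,i(n)\in\mathbf N$, all $a_j\in A$ and all permutations $\sigma$ of $\mathbf N$. For a symmetric state $\psi$: $\pi_\psi$ is the GNS representation of $\mathfrak A$ on $L^2(\mathfrak A,\psi)$, with canonical map $a\mapsto\hat a$ from $\mathfrak A$ onto a dense subspace, $\langle\hat a,\hat b\rangle=\psi(b^*a)$; $\pi_i=\pi_\psi\circ\lambda_i$; $\mathcal M_\psi=\pi_\psi(\mathfrak A)''$; $\hat\psi=\langle\,\cdot\,\hat 1,\hat 1\rangle$ is the vector state on $\mathcal M_\psi$. The tail algebra is $\mathcal T_\psi=\bigcap_{N\ge1}W^*(\bigcup_{i\ge N}\pi_i(A))$. $S_\infty$ is the group of finite permutations of $\mathbf N$; for $\sigma\in S_\infty$, $\beta_\sigma\in\mathrm{Aut}(\mathfrak A)$ is defined by $\beta_\sigma\circ\lambda_i=\lambda_{\sigma(i)}$, $U_\sigma$ is the unitary $U_\sigma\hat x=\widehat{\beta_\sigma(x)}$ on $L^2(\mathfrak A,\psi)$, and $\hat\beta_\sigma$ is the automorphism of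 $\mathcal M_\psi$ given by conjugation with $U_\sigma$. The fixed point algebra is $\mathcal F_\psi=\{x\in\mathcal M_\psi:\hat\beta_\sigma(x)=x\ \forall\sigma\in S_\infty\}$; one has $\mathcal T_\psi\subseteq\mathcal F_\psi$. $\mathcal R_\psi$ is the $C^*$-subalgebra of $\mathcal M_\psi$ generated by $\mathcal F_\psi\cup\pi_\psi(\mathfrak A)$ and $\mathcal Q_\psi$ is the $C^*$-subalgebra generated by $\mathcal T_\psi\cup\pi_\psi(\mathfrak A)$. $\alpha$ is the unique $*$-endomorphism of $\mathcal R_\psi$ satisfying $\alpha\circ\pi_i=\pi_{i+1}$ for all $i\in\mathbf N$ and $\alpha|_{\mathcal F_\psi}=\mathrm{id}$. *)

(* Defs.v *)
(* Scalars are the complex numbers R[i] over an arbitrary R : realType; R[i]^o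
   is R[i] with its norm topology. *)
From HB Require Import structures.
From mathcomp Require Import all_boot all_order all_algebra.
From mathcomp Require Import sesquilinear complex.
From mathcomp Require Import all_classical all_reals.
From mathcomp Require Import topology normedtype sequences.

Set Implicit Arguments.
Unset Strict Implicit.
Unset Printing Implicit Defensive.

Import Order.TTheory GRing.Theory Num.Theory.
Import numFieldNormedType.Exports.

Local Open Scope classical_set_scope.
Local Open Scope ring_scope.

(* Unital C*-algebras.  The product is declared in the mixin and then exported
   as the ring product, because the hierarchy has no join of normed modules
   and rings.  The condition 1 != 0 only excludes the zero algebra, on which
   (and on whose free powers) there is no state. *)
HB.mixin Record isCStarAlgebra (R : realType) A
    of CompleteNormedModule R[i] A := {
  cstar_one : A;
  cstar_mul : A -> A -> A;
  star : A -> A;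
  cstar_mulA : associative cstar_mul;
  cstar_mul1l : left_id cstar_one cstar_mul;
  cstar_mul1r : right_id cstar_one cstar_mul;
  cstar_mulDl : left_distributive cstar_mul +%R;
  cstar_mulDr : right_distributive cstar_mul +%R;
  cstar_one_neq0 : cstar_one != 0;
  cstar_scalerAl : forall (c : R[i]) a b,
    c *: cstar_mul a b = cstar_mul (c *: a) b;
  cstar_scalerAr : forall (c : R[i]) a b,
    c *: cstar_mul a b = cstar_mul a (c *: b);
  starD : {morph star : a b / a + b};
  starZ : forall (c : R[i]) a, star (c *: a) = c^* *: star a;
  star_mul : forall a b, star (cstar_mul a b) = cstar_mul (star b) (star a);
  starK : involutive star;
  cstar_norm_mul : forall a b : A, `|cstar_mul a b| <= `|a| * `|b|;
  cstar_norm_star : forall a : A, `|cstar_mul (star a) a| = `|a| ^+ 2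
}.

#[short(type="cstarAlgType")]
HB.structure Definition CStarAlgebra (R : realType) :=
  {A of isCStarAlgebra R A & CompleteNormedModule R[i] A}.

#[non_forgetful_inheritance]
HB.instance Definition _ (R : realType) (A : cstarAlgType R) :=
  GRing.Zmodule_isNzRing.Build A
    (@cstar_mulA R A) (@cstar_mul1l R A) (@cstar_mul1r R A)
    (@cstar_mulDl R A) (@cstar_mulDr R A) (@cstar_one_neq0 R A).
#[non_forgetful_inheritance]
HB.instance Definition _ (R : realType) (A : cstarAlgType R) :=
  GRing.Lmodule_isLalgebra.Build R[i] A (@cstar_scalerAl R A).
#[non_forgetful_inheritance]
HB.instance Definition _ (R : realType) (A : cstarAlgType R) :=
  GRing.Lalgebra_isAlgebra.Build R[i] A (@cstar_scalerAr R A).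

(* The inner product is linear in its first argument. *)
HB.mixin Record isHilbert (R : realType) H of CompleteNormedModule R[i] H := {
  ip : {dot H for (@Num.conj R[i])};
  ip_norm : forall x : H, `|x| ^+ 2 = ip x x
}.

#[short(type="hilbertType")]
HB.structure Definition Hilbert (R : realType) :=
  {H of isHilbert R H & CompleteNormedModule R[i] H}.

Section AbstractCStarAlgebras.
Context {R : realType}.

Definition unital_star_hom (A B : cstarAlgType R) (f : A -> B) : Prop :=
  [/\ linear f, f 1 = 1, {morph f : a b / a * b} &
      forall a, f (star a) = star (f a)].

Definition cstar_subalgebra (A : cstarAlgType R) (S : set A) : Prop :=
  [/\ S 0,
      forall (c : R[i]) a b, S a -> S b -> S (c *: a + b),
      forall a b, S a -> S b -> S (a * b),
      forall a, S a -> S (star a) &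
      closed S].

(* AA, with the maps lam i, is the universal unital free product of countably
   many copies of A.  The generation clause also follows from the uniqueness
   in the universal property; so does the injectivity of the lam i. *)
Definition is_free_power (A AA : cstarAlgType R) (lam : nat -> A -> AA) :
    Prop :=
  [/\ forall i, unital_star_hom (lam i),
      smallest (@cstar_subalgebra AA) (\bigcup_i range (lam i)) = setT &
      forall (B : cstarAlgType R) (f : nat -> A -> B),
        (forall i, unital_star_hom (f i)) ->
        exists! g : AA -> B,
          unital_star_hom g /\ forall i a, g (lam i a) = f i a].

Definition is_state (A : cstarAlgType R) (psi : A -> R[i]) : Prop :=
  [/\ scalar psi, forall a, 0 <= psi (star a * a) & psi 1 = 1].

Definition is_symmetric (A AA : cstarAlgType R) (lam : nat -> A -> AA)
    (psi : AA -> R[i]) : Prop :=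
  forall (n : nat) (i : 'I_n -> nat) (a : 'I_n -> A) (s : nat -> nat),
    bijective s ->
    psi (\prod_(j < n) lam (i j) (a j)) =
    psi (\prod_(j < n) lam (s (i j)) (a j)).

Definition finite_perm (s : nat -> nat) : Prop :=
  bijective s /\ exists N : nat, forall i, (N <= i)%N -> s i = i.

Definition is_index_action (A AA : cstarAlgType R) (lam : nat -> A -> AA)
    (beta : (nat -> nat) -> AA -> AA) : Prop :=
  forall s, finite_perm s ->
    [/\ unital_star_hom (beta s), bijective (beta s) &
        forall i a, beta s (lam i a) = lam (s i) a].

End AbstractCStarAlgebras.

Section Operators.
Context {R : realType} {H : hilbertType R}.

(* B(H) as a subset of the pointwise vector space H -> H; the product of
   operators is composition. *)
Definition bounded_operators : set (H -> H) :=
  [set T | linear T /\ continuous T].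

Definition opnorm (T : H -> H) : R :=
  sup [set complex.Re `|T x| | x in [set x : H | `|x| <= 1]].

Definition is_adjoint (T S : H -> H) : Prop :=
  forall x y, ip (T x) y = ip x (S y).

(* Meaningful for T in B(H), where the adjoint exists and is unique. *)
Definition adjoint (T : H -> H) : H -> H := xget 0 [set S | is_adjoint T S].

Definition unitary (T : H -> H) : Prop :=
  [/\ bounded_operators T, adjoint T \o T = idfun & T \o adjoint T = idfun].

Definition commutant (S : set (H -> H)) : set (H -> H) :=
  [set T | bounded_operators T /\ forall x, S x -> T \o x = x \o T].

Definition von_neumann_algebra (M : set (H -> H)) : Prop :=
  [/\ M `<=` bounded_operators,
      forall x, M x -> M (adjoint x) &
      commutant (commutant M) = M].

Definition Wstar (X : set (H -> H)) : set (H -> H) :=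
  smallest von_neumann_algebra X.

Definition op_cstar_subalgebra (S : set (H -> H)) : Prop :=
  [/\ S `<=` bounded_operators,
      S 0 /\ (forall (c : R[i]) x y, S x -> S y -> S (c *: x + y)),
      forall x y, S x -> S y -> S (x \o y),
      forall x, S x -> S (adjoint x) &
      forall x, bounded_operators x ->
        (forall e : R, 0 < e -> exists2 y, S y & opnorm (x - y) < e) -> S x].

Definition Cstar (X : set (H -> H)) : set (H -> H) :=
  smallest op_cstar_subalgebra X.

Definition WOT_cvg (T_ : nat -> H -> H) (T : H -> H) : Prop :=
  forall xi eta : H,
    ((fun n => ip (T_ n xi) eta) : nat -> R[i]^o) @ \oo
      --> (ip (T xi) eta : R[i]^o).

(* G is only constrained on D, so [cond_exp D' E' G] with D' a subset of D
   speaks about the restriction of G to D'.  The last clause says that the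
   operator norm of G is 1 (sup is 0 on sets that are not bounded above). *)
Definition cond_exp (D E : set (H -> H)) (G : (H -> H) -> (H -> H)) : Prop :=
  [/\ E `<=` D,
      forall (c : R[i]) x y, D x -> D y -> G (c *: x + y) = c *: G x + G y,
      forall x, D x -> E (G x),
      forall x, E x -> G x = x &
      sup [set opnorm (G x) | x in [set x | D x /\ opnorm x <= 1]] = 1].

Definition star_endomorphism (D : set (H -> H))
    (alpha : (H -> H) -> (H -> H)) : Prop :=
  [/\ forall x, D x -> D (alpha x),
      forall (c : R[i]) x y, D x -> D y ->
        alpha (c *: x + y) = c *: alpha x + alpha y,
      forall x y, D x -> D y -> alpha (x \o y) = alpha x \o alpha y &
      forall x, D x -> alpha (adjoint x) = adjoint (alpha x)].

Section GNS.
Context {A AA : cstarAlgType R} (lam : nat -> A -> AA).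
Context (hat : AA -> H) (pi : AA -> H -> H).

(* H is L^2(AA, psi) with canonical map [hat], and [pi] is left
   multiplication; these conditions determine the triple up to a unique
   unitary equivalence. *)
Definition is_GNS (psi : AA -> R[i]) : Prop :=
  [/\ linear hat,
      dense (range hat),
      forall a b, ip (hat a) (hat b) = psi (star b * a),
      forall a, bounded_operators (pi a) &
      forall a b, pi a (hat b) = hat (a * b)].

Definition implements (beta : (nat -> nat) -> AA -> AA)
    (U : (nat -> nat) -> H -> H) : Prop :=
  forall s, finite_perm s ->
    unitary (U s) /\ forall x, U s (hat x) = hat (beta s x).

Definition conj_by (V : H -> H) (x : H -> H) : H -> H := V \o x \o adjoint V.

Definition vector_state (x : H -> H) : R[i] := ip (x (hat 1)) (hat 1).

Definition M_alg : set (H -> H) := commutant (commutant (range pi)).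

Definition tail_alg : set (H -> H) :=
  \bigcap_N Wstar (\bigcup_(i in [set i | (N <= i)%N]) range (pi \o lam i)).

Definition fixed_alg (U : (nat -> nat) -> H -> H) : set (H -> H) :=
  [set x | M_alg x /\ forall s, finite_perm s -> conj_by (U s) x = x].

Definition R_alg (U : (nat -> nat) -> H -> H) : set (H -> H) :=
  Cstar (fixed_alg U `|` range pi).

Definition Q_alg : set (H -> H) := Cstar (tail_alg `|` range pi).

Definition is_shift (U : (nat -> nat) -> H -> H)
    (alpha : (H -> H) -> (H -> H)) : Prop :=
  [/\ star_endomorphism (R_alg U) alpha,
      forall i a, alpha (pi (lam i a)) = pi (lam i.+1 a) &
      forall x, fixed_alg U x -> alpha x = x].

End GNS.
End Operators.

(* Main.v *)
Require Import Defs.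
From mathcomp Require Import all_boot all_order all_algebra.
From mathcomp Require Import sesquilinear complex.
From mathcomp Require Import all_classical all_reals.
From mathcomp Require Import topology normedtype sequences.
From mathcomp Require Import ring lra zify.

(** Write R, F, Q for the algebras R_alg pi U, fixed_alg pi U, Q_alg lam pi, and
    Ad V for conj_by V.

    An element x of R is, up to a small error in norm, a polynomial in elements
    of F and in the generators pi (lam i a) with i < N, for some N. Hence two
    unital star representations of R that agree on F and on those generators
    almost agree at x ([R_finitely_determined]). This is applied to alpha^m and
    to Ad (U r) o alpha^n, where the finite permutation r moves n + i to m + i
    for i < N and fixes the indices below n ([shift_block]). In the same way
    each vector of H is almost fixed by U r as soon as r fixes enough of the
    small indices ([U_almost_fixed]). Together these show that every matrix
    coefficient of alpha^n x is a Cauchy sequence in n ([iter_alpha_cauchy]), so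
    that the bounded sequence alpha^n x has a weak limit G x.

    The properties of G follow from comparisons of the same kind. If s fixes the
    indices from N on, then Ad (U s) fixes alpha^n x for n >= N, so G x lies in
    F. Each alpha^n x is close to some Ad (U r) x, and U r fixes hat 1, so G
    preserves the vector state. Applying Ad (U s) before alpha^n amounts to
    applying Ad (U s') after it, for a translate s' of s that fixes the indices
    below n, and this is invisible in the limit. Finally alpha^n maps Q into the
    von Neumann algebra generated by the pi (lam i a) with i >= n; these
    algebras are weakly closed and decrease to the tail algebra, so G maps Q
    into it.

    The approximations need alpha^n and pi to be contractive, although alpha is
    given only as a star endomorphism and pi through a positive functional. In
    a Banach star algebra, 1 - a has a self-adjoint square root when a is
    self-adjoint of norm less than 1 ([square_root]); so a star representation
    Phi maps 1 - star x * x to a positive operator when x has norm less than 1,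
    which says that Phi x is a contraction ([star_rep_contractive]). Adjoints
    and weak limits of operators are obtained from the Riesz representation
    theorem ([riesz_representation]). *)

Set Implicit Arguments.
Unset Strict Implicit.
Unset Printing Implicit Defensive.

Import Order.TTheory GRing.Theory Num.Theory.
Import numFieldNormedType.Exports.

Local Open Scope classical_set_scope.
Local Open Scope complex_scope.
Local Open Scope ring_scope.

(** * Real-valued norms and limits *)

(** The norm takes values in the complex numbers, which are only partially
    ordered; its real part carries the same information and can be used in
    real arithmetic. *)
Definition nr {R : realType} {V : normedZmodType R[i]} (x : V) : R :=
  complex.Re `|x|.

Definition tends_to {R : realType} {V : normedZmodType R[i]} (u : nat -> V)
    (l : V) : Prop :=
  forall e : R, 0 < e -> exists N, forall n, (N <= n)%N -> nr (u n - l) <= e.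

Section RealNorm.
Context {R : realType}.
Implicit Types (V : normedModType R[i]).

Lemma complex_ge0E (z : R[i]) : 0 <= z -> z = (complex.Re z)%:C.
Proof. by move=> /ger0_Im; case: z => a b /= ->. Qed.

Lemma nrE (V : normedZmodType R[i]) (x : V) : `|x| = (nr x)%:C.
Proof. exact/complex_ge0E/normr_ge0. Qed.

Lemma nr_ge0 (V : normedZmodType R[i]) (x : V) : 0 <= nr x.
Proof. by rewrite -lecR -nrE normr_ge0. Qed.

Lemma nr0 (V : normedZmodType R[i]) : nr (0 : V) = 0.
Proof. by rewrite /nr normr0. Qed.

Lemma nrN (V : normedZmodType R[i]) (x : V) : nr (- x) = nr x.
Proof. by rewrite /nr normrN. Qed.

Lemma nr_distC (V : normedZmodType R[i]) (x y : V) : nr (x - y) = nr (y - x).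
Proof. by rewrite /nr distrC. Qed.

Lemma nr0_eq0 (V : normedZmodType R[i]) (x : V) : nr x = 0 -> x = 0.
Proof. by move=> h; apply/normr0_eq0; rewrite nrE h. Qed.

Lemma ler_nrD (V : normedZmodType R[i]) (x y : V) : nr (x + y) <= nr x + nr y.
Proof. by rewrite -lecR rmorphD /= -!nrE ler_normD. Qed.

Lemma nrZ V (c : R[i]) (x : V) : nr (c *: x) = nr c * nr x.
Proof. by apply: (@complexI R); rewrite rmorphM /= -!nrE normrZ. Qed.

Lemma nrM (a b : R[i]) : nr (a * b) = nr a * nr b.
Proof. by apply: (@complexI R); rewrite rmorphM /= -!nrE normrM. Qed.

Lemma nr_real (t : R) : nr (t%:C : R[i]) = `|t|.
Proof. by rewrite /nr normc_def /= expr0n /= addr0 sqrtr_sqr. Qed.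

Lemma nr1 : nr (1 : R[i]) = 1.
Proof. by rewrite -[1]/(1%:C) nr_real normr1. Qed.

Lemma nr_conj (c : R[i]) : nr (c^*) = nr c.
Proof. by rewrite /nr !normc_def; case: c => a b /=; rewrite sqrrN. Qed.

Lemma Re_le_nr (c : R[i]) : complex.Re c <= nr c.
Proof.
have := normc_ge_Re c; rewrite nrE lecR; apply: le_trans; exact: ler_norm.
Qed.

Lemma nr_small_eq0 (V : normedZmodType R[i]) (x : V) :
  (forall e, 0 < e -> nr x <= e) -> x = 0.
Proof.
move=> h; apply: nr0_eq0; apply/eqP; rewrite eq_le nr_ge0 andbT.
by apply/ler_addgt0Pr => e /h; rewrite add0r.
Qed.

Lemma tends_toP V (u : nat -> V) (l : V) :
  u @ \oo --> l <-> tends_to u l.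
Proof.
split.
  move=> /cvgrPdist_lt h e e0.
  have e0' : 0 < e%:C by rewrite -[0]/(0%:C) ltcR.
  have [N _ hN] := h _ e0'.
  exists N => n Nn; rewrite nr_distC -lecR -nrE; exact/ltW/hN.
move=> h; apply/cvgrPdist_le => e e0.
have eE := complex_ge0E (ltW e0).
have e0' : 0 < complex.Re e by rewrite -ltcR -eE.
have [N hN] := h _ e0'.
by exists N => // n Nn /=; rewrite eE distrC nrE lecR; exact: hN.
Qed.

Lemma nr_complete (V : completeNormedModType R[i]) (u : nat -> V) :
  (forall e : R, 0 < e -> exists N, forall n m, (N <= n)%N -> (N <= m)%N ->
     nr (u n - u m) <= e) ->
  exists l : V,
    tends_to u l.
Proof.
move=> h.
suff /cvg_ex[l /tends_toP ul] : cvg (u @ \oo) by exists l.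
apply/cauchy_cvgP/cauchy_ballP => e e0.
have eE := complex_ge0E (ltW e0).
have e0' : 0 < complex.Re e by rewrite -ltcR -eE.
have e02 : 0 < complex.Re e / 2 by rewrite divr_gt0.
have [N hN] := h _ e02.
exists ([set x | exists2 n, (N <= n)%N & x = u n],
        [set x | exists2 n, (N <= n)%N & x = u n]) => /=.
  by split; exists N => // n Nn /=; exists n.
move=> [x y] /= [[n Nn ->] [m Nm ->]].
rewrite -ball_normE /= eE nrE ltcR.
apply: le_lt_trans (hN _ _ Nn Nm) _.
by rewrite ltr_pdivrMr // ltr_pMr // ltr1n.
Qed.

Lemma dense_nr V (S : set V) : dense S ->
  forall (x : V) (e : R), 0 < e -> exists2 y, S y & nr (y - x) <= e.
Proof.
move=> dS x e e0.
have e0' : 0 < e%:C by rewrite -[0]/(0%:C) ltcR.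
have [y [xy Sy]] := dS (interior (ball x e%:C))
  (ex_intro _ x (nbhsx_ballx x e%:C e0')) (@open_interior _ _).
exists y => //.
have := interior_subset xy.
by rewrite -ball_normE /= nr_distC nrE ltcR => /ltW.
Qed.

End RealNorm.

(** * Inner products, the Riesz theorem and adjoints *)

Section InnerProduct.
Context {R : realType} {H : hilbertType R}.
Implicit Types x y z : H.

Lemma ipDl x y z : ip (x + y) z = ip x z + ip y z.
Proof. exact: linearDl. Qed.

Lemma ipDr x y z : ip x (y + z) = ip x y + ip x z.
Proof. exact: linearDr. Qed.

Lemma ipZl c x y : ip (c *: x) y = c * ip x y.
Proof. by rewrite linearZl_LR. Qed.

Lemma ipZr c x y : ip x (c *: y) = c^* * ip x y.
Proof. by rewrite linearZr_LR. Qed.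

Lemma ip0l x : ip 0 x = 0.
Proof. by rewrite -[0 : H](scale0r (0 : H)) ipZl mul0r. Qed.

Lemma ip0r x : ip x 0 = 0.
Proof. by rewrite -[0 : H](scale0r (0 : H)) ipZr conjC0 mul0r. Qed.

Lemma ipNl x y : ip (- x) y = - ip x y.
Proof. by rewrite -scaleN1r ipZl mulN1r. Qed.

Lemma ipNr x y : ip x (- y) = - ip x y.
Proof. by rewrite -scaleN1r ipZr rmorphN1 mulN1r. Qed.

Lemma ipBl x y z : ip (x - y) z = ip x z - ip y z.
Proof. by rewrite ipDl ipNl. Qed.

Lemma ipBr x y z : ip x (y - z) = ip x y - ip x z.
Proof. by rewrite ipDr ipNr. Qed.

Lemma ipC x y : ip x y = (ip y x)^*.
Proof. by rewrite (hermC (ip : {dot H for Num.conj}) x y) expr0 mul1r. Qed.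

Lemma Re_conj (c : R[i]) : complex.Re c^* = complex.Re c.
Proof. by case: c. Qed.

Lemma ReD (a b : R[i]) : complex.Re (a + b) = complex.Re a + complex.Re b.
Proof. by case: a b => ? ? []. Qed.

Lemma ReN (a : R[i]) : complex.Re (- a) = - complex.Re a.
Proof. by case: a. Qed.

Lemma ReMr (t : R) (a : R[i]) : complex.Re (t%:C * a) = t * complex.Re a.
Proof. by case: a => a b /=; rewrite mul0r subr0. Qed.

Lemma conj_real (t : R) : (t%:C : R[i])^* = t%:C.
Proof. by apply: conj_Creal; apply/complex_realP; exists t. Qed.

Lemma ipxx x : ip x x = (nr x ^+ 2)%:C.
Proof. by rewrite -ip_norm nrE rmorphXn. Qed.

Lemma nrD_sq x y :
  nr (x + y) ^+ 2 = nr x ^+ 2 + nr y ^+ 2 + 2 * complex.Re (ip x y).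
Proof.
have : complex.Re (ip (x + y) (x + y)) = nr (x + y) ^+ 2 by rewrite ipxx.
rewrite ipDl !ipDr !ReD (ipC y x) Re_conj !ipxx /= => <-; ring.
Qed.

Lemma nrB_sq x y :
  nr (x - y) ^+ 2 = nr x ^+ 2 + nr y ^+ 2 - 2 * complex.Re (ip x y).
Proof. by rewrite nrD_sq nrN ipNr ReN mulrN. Qed.

Lemma cauchy_schwarz x y : nr (ip x y) <= nr x * nr y.
Proof.
have [->|y0] := eqVneq y 0; first by rewrite ip0r !nr0 mulr0.
have ny0 : 0 < nr y.
  by rewrite lt_neqAle nr_ge0 andbT eq_sym; apply: contraNneq y0 => /nr0_eq0 ->.
set c := ip x y.
have := sqr_ge0 (nr (x - ((nr y ^- 2)%:C * c) *: y)).
rewrite nrB_sq ipZr rmorphM /= conj_real -/c -mulrA ReMr nrZ nrM nr_real.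
rewrite [c^* * c]mulrC -normCK nrE -rmorphXn /=.
rewrite ger0_norm ?invr_ge0 ?sqr_ge0 //.
rewrite (_ : _ + _ - _ = nr x ^+ 2 - (nr c / nr y) ^+ 2); last first.
  by field; rewrite gt_eqF.
rewrite subr_ge0 => h.
rewrite -ler_pdivrMr // -(@ler_pXn2r _ 2) // nnegrE ?nr_ge0 //.
by rewrite divr_ge0 ?nr_ge0.
Qed.

Lemma ip_eq0 x : (forall y, ip y x = 0) -> x = 0.
Proof.
move=> /(_ x); rewrite ipxx => /(@complexI R _ 0)/eqP.
by rewrite sqrf_eq0 => /eqP/nr0_eq0.
Qed.

Lemma ip_inj x y : (forall z, ip z x = ip z y) -> x = y.
Proof.
move=> h; apply/eqP; rewrite -subr_eq0; apply/eqP/ip_eq0 => z.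
by rewrite ipBr h subrr.
Qed.

(** Pairing x with itself already attains the norm. *)
Lemma nr_le_ip x (M : R) : 0 <= M ->
  (forall y, nr (ip x y) <= M * nr y) -> nr x <= M.
Proof.
move=> M0 /(_ x); rewrite ipxx nr_real ger0_norm ?sqr_ge0 // expr2.
have [->|nx] := eqVneq (nr x) 0; first by [].
by rewrite ler_pM2r // lt_neqAle nr_ge0 eq_sym nx.
Qed.

(** Reads off a vanishing first variation at a minimum. *)
Lemma linear_term_eq0 (d k : R) : 0 <= k ->
  (forall t, 0 <= 2 * t * d + t ^+ 2 * k) -> d = 0.
Proof.
move=> k0 /(_ (- d / (k + 1))).
have k1 : 0 < k + 1 by rewrite ltr_wpDl.
rewrite (_ : _ + _ = - (d ^+ 2 * (k + 2) / (k + 1) ^+ 2)); last first.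
  by field; rewrite gt_eqF.
rewrite oppr_ge0 pmulr_lle0 ?invr_gt0 ?exprn_gt0 // pmulr_lle0; last lra.
by move=> h; apply/eqP; rewrite -sqrf_eq0 eq_le h sqr_ge0.
Qed.

(** Recovers a complex-linear functional from its real part, since
    multiplication by 'i passes through the functional. *)
Lemma Re_complexE (c : R[i]) :
  c = (complex.Re c)%:C - 'i * (complex.Re ('i * c))%:C.
Proof.
rewrite -complexiE.
by case: c => a b; apply/eqP; rewrite eq_complex /=; apply/andP; split;
  apply/eqP; ring.
Qed.

Lemma exists_invn_le (e : R) : 0 < e ->
  exists N, forall n, (N <= n)%N -> n.+1%:R^-1 <= e.
Proof.
move=> e0; exists (Num.bound e^-1) => n Nn.
rewrite invf_ple ?posrE //.
have e1 : 0 <= e^-1 by rewrite invr_ge0 ltW.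
apply: le_trans (ltW (archi_boundP e1)) _.
by rewrite ler_nat leqW.
Qed.

Section Riesz.
Variables (f : H -> R[i]) (M : R).
Hypotheses (fD : forall x y, f (x + y) = f x + f y).
Hypotheses (fZ : forall c x, f (c *: x) = c * f x).
Hypotheses (fM : forall x, nr (f x) <= M * nr x).

(** If z represents f, this is nr (x - z) ^+ 2 - nr z ^+ 2, so z is found by
    minimizing it. *)
Let J x := nr x ^+ 2 - 2 * complex.Re (f x).

Let J_bounded x : - M ^+ 2 <= J x.
Proof.
have h : complex.Re (f x) <= M * nr x := le_trans (Re_le_nr _) (fM x).
rewrite /J; have := sqr_ge0 (nr x - M); nra.
Qed.

Let has_inf_J : has_inf (range J).
Proof.
by split; [exists (J 0), 0 | exists (- M ^+ 2) => _ [x _ <-]; exact: J_bounded].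
Qed.

Let J_parallelogram x y :
  nr (x - y) ^+ 2 = 2 * J x + 2 * J y - 4 * J ((2^-1)%:C *: (x + y)).
Proof.
rewrite /J nrZ exprMn fZ ReMr nr_real ger0_norm ?invr_ge0 // fD ReD.
by rewrite nrB_sq nrD_sq; field.
Qed.

(** J is bounded below, and the parallelogram identity makes a minimizing
    sequence Cauchy; the limit represents f because the first variation of J
    vanishes there. *)
Lemma riesz_representation : exists z, forall x, f x = ip x z.
Proof.
pose I := inf (range J).
have IJ x : I <= J x.
  by apply: ge_inf; [case: has_inf_J | exists x].
have ex n : exists x, J x < I + n.+1%:R^-1.
  have n0 : 0 < (n.+1%:R : R)^-1 by rewrite invr_gt0.
  by have [_ [x _ <-] h] := inf_adherent n0 has_inf_J; exists x.
have [u uI] := choice ex.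
have small e : 0 < e -> exists N, forall n, (N <= n)%N -> J (u n) <= I + e.
  move=> e0; have [N hN] := exists_invn_le e0; exists N => n Nn.
  by apply/ltW/(lt_le_trans (uI n)); rewrite lerD2l hN.
have [z uz] : exists z, tends_to u z.
  apply: nr_complete => e e0.
  have e4 : 0 < e ^+ 2 / 4 by rewrite divr_gt0 ?exprn_gt0.
  have [N hN] := small _ e4; exists N => n m Nn Nm.
  rewrite -(@ler_pXn2r _ 2) // ?nnegrE ?nr_ge0 ?(ltW e0) //.
  rewrite J_parallelogram.
  have := IJ ((2^-1)%:C *: (u n + u m)).
  move: (hN _ Nn) (hN _ Nm); lra.
(* J (u n + t h) >= inf J >= J (u n) - e / 2 for large n; as n grows, this
   becomes an inequality at z that is quadratic in t. *)
have Re_eq h : complex.Re (f h) = complex.Re (ip h z).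
  apply/esym/eqP; rewrite -subr_eq0; apply/eqP.
  apply: (@linear_term_eq0 _ (nr h ^+ 2)); first exact: sqr_ge0.
  move=> t; apply/ler_addgt0Pr => e e0.
  have c0 : 0 < 1 + 2 * `|t| * nr h.
    by rewrite ltr_wpDr // !mulr_ge0 // nr_ge0.
  have e2 : 0 < e / 2 by rewrite divr_gt0.
  have e3 : 0 < e / 2 / (1 + 2 * `|t| * nr h) by rewrite divr_gt0.
  have [N1 h1] := small _ e2; have [N2 h2] := uz _ e3.
  pose n := maxn N1 N2.
  have {}h1 := h1 n (leq_maxl _ _); have {}h2 := h2 n (leq_maxr _ _).
  have := IJ (u n + t%:C *: h).
  rewrite /J nrD_sq nrZ exprMn nr_real real_normK ?num_real // fD fZ !ReD !ReMr.
  rewrite ipZr conj_real ReMr (ipC (u n)) Re_conj => hI.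
  have {}h1 : nr (u n) ^+ 2 - 2 * complex.Re (f (u n)) <= I + e / 2 := h1.
  have : t * complex.Re (ip h (u n - z)) <= `|t| * (nr h * nr (u n - z)).
    apply: le_trans (ler_norm _) _; rewrite normrM ler_wpM2l //.
    rewrite ler_norml (le_trans (Re_le_nr _) (cauchy_schwarz _ _)) andbT.
    rewrite lerNl -ReN -ipNr -(nrN (u n - z)).
    exact: le_trans (Re_le_nr _) (cauchy_schwarz _ _).
  rewrite ipBr ReD ReN.
  have : 2 * (`|t| * (nr h * nr (u n - z))) <= e / 2.
    move: h2; rewrite ler_pdivlMr // => h2; apply: le_trans h2.
    have := nr_ge0 (u n - z); lra.
  lra.
exists z => h.
rewrite [f h]Re_complexE [ip h z]Re_complexE Re_eq -fZ -ipZl Re_eq //.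
Qed.
End Riesz.

Lemma linear_eqs (T : H -> H) : linear T ->
  [/\ T 0 = 0, {morph T : x y / x + y}, (forall c x, T (c *: x) = c *: T x) &
      {morph T : x y / x - y}].
Proof.
move=> lT.
have TD : {morph T : x y / x + y}.
  by move=> x y; have := lT 1 x y; rewrite !scale1r.
have T0 : T 0 = 0.
  have /eqP := TD 0 0.
  by rewrite addr0 -subr_eq0 opprD addNKr oppr_eq0 => /eqP.
have TZ c x : T (c *: x) = c *: T x.
  by have := lT c x 0; rewrite addr0 T0 addr0.
split=> // x y; rewrite TD -[- y]scaleN1r TZ scaleN1r //.
Qed.

Lemma bounded_operatorsP (T : H -> H) : bounded_operators T <->
  linear T /\ exists2 M, 0 <= M & forall x, nr (T x) <= M * nr x.
Proof.
split=> [[lT cT]|[lT [M M0 hM]]]; split=> //; have [T0 TD TZ TB] := linear_eqs lT.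
  have := cT 0; move/cvgrPdist_lt/(_ _ ltr01)/nbhs_ballP => [e /= e0 he].
  have eE := complex_ge0E (ltW e0).
  set d := complex.Re e in eE; have d0 : 0 < d by rewrite -ltcR -eE.
  exists (2 / d); first by rewrite divr_ge0 ?ltW.
  move=> x; have [x0|nx0] := eqVneq (nr x) 0; last first.
    have nx : 0 < nr x by rewrite lt_neqAle nr_ge0 eq_sym nx0.
    have := he ((d / 2 / nr x)%:C *: x).
    rewrite -ball_normE /= sub0r normrN eE nrE ltcR nrZ nr_real.
    rewrite ger0_norm; last first.
      by rewrite !divr_ge0 // ltW.
    rewrite divfK // ltr_pdivrMr // ltr_pMr // ltr1n => /(_ isT).
    rewrite T0 sub0r normrN nrE -[X in _ < X]/(1%:C) ltcR TZ nrZ nr_real.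
    rewrite ger0_norm; last first.
      by rewrite !divr_ge0 // ltW.
    rewrite mulrC mulrA ltr_pdivrMr // mul1r => h.
    rewrite mulrAC ler_pdivlMr //; lra.
  by rewrite (nr0_eq0 x0) T0 nr0 mulr0.
move=> x; apply/cvgrPdist_le => e e0.
have eE := complex_ge0E (ltW e0).
set d := complex.Re e in eE; have d0 : 0 < d by rewrite -ltcR -eE.
have M1 : 0 < M + 1 by rewrite ltr_wpDl.
apply/nbhs_ballP; exists (d / (M + 1))%:C; first by rewrite /= ltcR divr_gt0.
move=> y; rewrite -ball_normE /= -TB eE !nrE lecR ltcR => h.
apply: le_trans (hM _) _.
move: h; rewrite ltr_pdivlMr // => /ltW; apply: le_trans.
by rewrite mulrC ler_wpM2l ?nr_ge0 // lerDl.
Qed.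

(** For each y, the Riesz theorem represents x |-> ip (T x) y. *)
Lemma adjoint_exists (T : H -> H) : bounded_operators T ->
  exists S, is_adjoint T S.
Proof.
move=> /bounded_operatorsP[lT [M M0 hM]]; have [T0 TD TZ TB] := linear_eqs lT.
suff /choice[S hS] : forall y, exists z, forall x, ip (T x) y = ip x z.
  by exists S => x y; exact: hS.
move=> y; apply: (@riesz_representation _ (M * nr y)).
- by move=> x z; rewrite TD ipDl.
- by move=> c x; rewrite TZ ipZl.
by move=> x; rewrite mulrAC; apply: le_trans (cauchy_schwarz _ _) _;
  rewrite ler_wpM2r ?nr_ge0.
Qed.

Lemma adjointP (T : H -> H) : bounded_operators T -> is_adjoint T (adjoint T).
Proof. by move=> /adjoint_exists[S hS]; exact: (xgetPex 0 (ex_intro _ S hS)). Qed.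

Lemma adjoint_unique (T S S' : H -> H) :
  is_adjoint T S -> is_adjoint T S' -> S = S'.
Proof.
by move=> h h'; apply/funext => y; apply: ip_inj => z; rewrite -h -h'.
Qed.

Lemma adjointE (T S : H -> H) : is_adjoint T S -> adjoint T = S.
Proof.
by move=> h; apply: (adjoint_unique _ h); exact: (xgetPex 0 (ex_intro _ S h)).
Qed.

Lemma is_adjoint_sym (T S : H -> H) : is_adjoint T S -> is_adjoint S T.
Proof. by move=> h x y; rewrite ipC -h -ipC. Qed.

Lemma is_adjoint_linear (T S : H -> H) : is_adjoint T S -> linear S.
Proof.
move=> h c x y; apply: ip_inj => z.
by rewrite -h ipDr ipZr !h -ipZr -ipDr.
Qed.

Lemma is_adjoint_bound (T S : H -> H) (M : R) : 0 <= M ->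
  (forall x, nr (T x) <= M * nr x) -> is_adjoint T S ->
  forall x, nr (S x) <= M * nr x.
Proof.
move=> M0 hM h x; apply: nr_le_ip; first by rewrite mulr_ge0 ?nr_ge0.
move=> y; rewrite (is_adjoint_sym h); apply: le_trans (cauchy_schwarz _ _) _.
by rewrite [nr x * _]mulrC [leRHS]mulrAC ler_wpM2r ?nr_ge0.
Qed.
End InnerProduct.

(** * The operator norm and C*-algebras of operators *)

Section OperatorNorm.
Context {R : realType} {H : hilbertType R}.
Implicit Types (S T x y : H -> H).

Lemma bounded_linear T : bounded_operators T ->
  [/\ T 0 = 0, {morph T : u v / u + v}, (forall c u, T (c *: u) = c *: T u) &
      {morph T : u v / u - v}].
Proof. by case=> /linear_eqs. Qed.

Lemma boundedI T (M : R) : linear T -> 0 <= M ->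
  (forall u, nr (T u) <= M * nr u) -> bounded_operators T.
Proof. by move=> lT M0 hM; apply/bounded_operatorsP; split=> //; exists M. Qed.

Lemma opnorm_le T (M : R) : 0 <= M ->
  (forall u, nr (T u) <= M * nr u) -> opnorm T <= M.
Proof.
move=> M0 hM; apply: sup_le_ub.
  by exists (complex.Re `|T 0|), 0 => //=; rewrite normr0.
move=> _ [u /= u1 <-]; apply: le_trans (hM u) _.
by rewrite ler_piMr // -lecR -nrE.
Qed.

Lemma opnorm_sup T : bounded_operators T ->
  has_sup [set complex.Re `|T u| | u in [set u : H | `|u| <= 1]].
Proof.
move=> /bounded_operatorsP[lT [M M0 hM]]; split.
  by exists (complex.Re `|T 0|), 0 => //=; rewrite normr0.
exists M => _ [u /= u1 <-]; apply: le_trans (hM u) _.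
by rewrite ler_piMr // -lecR -nrE.
Qed.

Lemma opnorm_ge0 T : bounded_operators T -> 0 <= opnorm T.
Proof.
move=> bT; apply: le_trans (sup_upper_bound (opnorm_sup bT) _); last first.
  by exists 0 => //=; rewrite normr0.
exact: nr_ge0.
Qed.

Lemma opnormP T u : bounded_operators T -> nr (T u) <= opnorm T * nr u.
Proof.
move=> bT; have [T0 _ TZ _] := bounded_linear bT.
have [u0|nu0] := eqVneq (nr u) 0.
  by rewrite (nr0_eq0 u0) T0 nr0 mulr0.
have nu : 0 < nr u by rewrite lt_neqAle nr_ge0 eq_sym nu0.
rewrite -ler_pdivrMr // mulrC.
have -> : (nr u)^-1 * nr (T u) = nr (T ((nr u)^-1%:C *: u)).
  by rewrite TZ nrZ nr_real ger0_norm // invr_ge0 ltW.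
apply: (sup_upper_bound (opnorm_sup bT)); eexists; last by [].
rewrite /= nrE -[X in _ <= X]/(1%:C) lecR nrZ nr_real ger0_norm ?mulVf //.
by rewrite invr_ge0 ltW.
Qed.

Lemma bounded_lin (c : R[i]) x y : bounded_operators x -> bounded_operators y ->
  bounded_operators (c *: x + y).
Proof.
move=> bx by_.
have [x0 xD xZ _] := bounded_linear bx; have [y0 yD yZ _] := bounded_linear by_.
apply: (@boundedI _ (nr c * opnorm x + opnorm y)).
- move=> d u v; rewrite !fctE xD yD xZ yZ !scalerDr !scalerA mulrC.
  by rewrite -!addrA; congr (_ + _); rewrite addrCA.
- by rewrite addr_ge0 ?mulr_ge0 ?nr_ge0 ?opnorm_ge0.
move=> u; rewrite !fctE; apply: le_trans (ler_nrD _ _) _.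
rewrite mulrDl lerD // ?opnormP // nrZ -mulrA ler_wpM2l ?nr_ge0 //.
exact: opnormP.
Qed.

Lemma bounded0 : bounded_operators (0 : H -> H).
Proof.
apply: (@boundedI _ 0) => // [c u v|u]; first by rewrite [RHS]addr0 scaler0.
by rewrite nr0 mul0r.
Qed.

Lemma bounded_id : bounded_operators (idfun : H -> H).
Proof. by apply: (@boundedI _ 1) => // u; rewrite mul1r. Qed.

Lemma scaleN1_add x y : (-1 : R[i]) *: y + x = x - y.
Proof. by rewrite scaleN1r addrC. Qed.

Lemma boundedB x y : bounded_operators x -> bounded_operators y ->
  bounded_operators (x - y).
Proof. by move=> bx by_; rewrite -scaleN1_add; exact: bounded_lin. Qed.

Lemma bounded_comp x y : bounded_operators x -> bounded_operators y ->
  bounded_operators (x \o y).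
Proof.
move=> bx by_.
have [x0 xD xZ _] := bounded_linear bx; have [y0 yD yZ _] := bounded_linear by_.
apply: (@boundedI _ (opnorm x * opnorm y)).
- by move=> c u v /=; rewrite yD yZ xD xZ.
- by rewrite mulr_ge0 ?opnorm_ge0.
move=> u /=; apply: le_trans (opnormP _ bx) _.
by rewrite -mulrA ler_wpM2l ?opnorm_ge0 ?opnormP.
Qed.

Lemma is_adjoint_bounded x y : bounded_operators x -> is_adjoint x y ->
  bounded_operators y.
Proof.
move=> bx xy; apply: (@boundedI _ (opnorm x)).
- exact: is_adjoint_linear xy.
- exact: opnorm_ge0.
by apply: is_adjoint_bound xy; [exact: opnorm_ge0 | move=> u; exact: opnormP].
Qed.

Lemma bounded_adj x : bounded_operators x -> bounded_operators (adjoint x).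
Proof. by move=> bx; apply: is_adjoint_bounded (adjointP bx). Qed.

Lemma adjointK x : bounded_operators x -> adjoint (adjoint x) = x.
Proof. by move=> bx; apply/adjointE/is_adjoint_sym/adjointP. Qed.

Lemma adjoint_comp x y : bounded_operators x -> bounded_operators y ->
  adjoint (x \o y) = adjoint y \o adjoint x.
Proof.
by move=> bx by_; apply: adjointE => u v /=; rewrite !adjointP.
Qed.

Lemma adjoint_lin c x y : bounded_operators x -> bounded_operators y ->
  adjoint (c *: x + y) = c^* *: adjoint x + adjoint y.
Proof.
move=> bx by_; apply: adjointE => u v.
by rewrite !fctE ipDl ipZl !adjointP // ipDr ipZr conjCK.
Qed.

Lemma adjoint_id : adjoint (idfun : H -> H) = idfun.
Proof. exact: adjointE. Qed.

Lemma opnorm_adj x : bounded_operators x -> opnorm (adjoint x) <= opnorm x.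
Proof.
move=> bx; apply: opnorm_le; first exact: opnorm_ge0.
by apply: is_adjoint_bound (adjointP bx);
  [exact: opnorm_ge0 | move=> u; exact: opnormP].
Qed.

Lemma opnormD x y : bounded_operators x -> bounded_operators y ->
  opnorm (x + y) <= opnorm x + opnorm y.
Proof.
move=> bx by_; apply: opnorm_le; first by rewrite addr_ge0 ?opnorm_ge0.
move=> u; apply: le_trans (ler_nrD _ _) _.
by rewrite mulrDl lerD // opnormP.
Qed.

Lemma opnormZ_le c x : bounded_operators x ->
  opnorm (c *: x) <= nr c * opnorm x.
Proof.
move=> bx; apply: opnorm_le; first by rewrite mulr_ge0 ?nr_ge0 ?opnorm_ge0.
by move=> u; rewrite !fctE nrZ -mulrA ler_wpM2l ?nr_ge0 ?opnormP.
Qed.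

Lemma opnormM x y : bounded_operators x -> bounded_operators y ->
  opnorm (x \o y) <= opnorm x * opnorm y.
Proof.
move=> bx by_; apply: opnorm_le; first by rewrite mulr_ge0 ?opnorm_ge0.
move=> u /=; apply: le_trans (opnormP _ bx) _.
by rewrite -mulrA ler_wpM2l ?opnorm_ge0 ?opnormP.
Qed.

Lemma opnorm_eq0 x : bounded_operators x -> opnorm x = 0 -> x = 0.
Proof.
move=> bx x0; apply/funext => u; apply: nr0_eq0; apply/eqP.
by rewrite eq_le nr_ge0 andbT; apply: le_trans (opnormP _ bx) _; rewrite x0 mul0r.
Qed.

Lemma comp_linl x (c : R[i]) y z : (c *: y + z) \o x = c *: (y \o x) + (z \o x).
Proof. by []. Qed.

Lemma comp_linr x (c : R[i]) y z : bounded_operators x ->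
  x \o (c *: y + z) = c *: (x \o y) + (x \o z).
Proof.
by move=> /bounded_linear[_ xD xZ _]; apply/funext => u; rewrite !fctE xD xZ.
Qed.

Lemma op_cstar_bounded : op_cstar_subalgebra (@bounded_operators R H).
Proof.
split=> //; [split=> [|c x y]| |].
- exact: bounded0.
- exact: bounded_lin.
- exact: bounded_comp.
- exact: bounded_adj.
Qed.

Lemma op_cstarB (S : set (H -> H)) x y : op_cstar_subalgebra S ->
  S x -> S y -> S (x - y).
Proof. by move=> [_ [_ h] _ _ _] Sx Sy; rewrite -scaleN1_add; exact: h. Qed.

Lemma Cstar_min (X S : set (H -> H)) :
  op_cstar_subalgebra S -> X `<=` S -> Cstar X `<=` S.
Proof. by move=> hS XS x; apply. Qed.

Lemma Cstar_gen (X : set (H -> H)) : X `<=` Cstar X.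
Proof. exact: sub_gen_smallest. Qed.

Lemma Cstar_op_cstar (X : set (H -> H)) : X `<=` bounded_operators ->
  op_cstar_subalgebra (Cstar X).
Proof.
move=> Xb; split.
- exact: Cstar_min op_cstar_bounded Xb.
- split=> [S [[_ [S0 _] _ _ _] _] //|c x y hx hy S [hS XS]].
  by case: (hS) => _ [_ h] _ _ _; apply: h; [apply: hx | apply: hy].
- move=> x y hx hy S [hS XS].
  by case: (hS) => _ _ h _ _; apply: h; [apply: hx | apply: hy].
- by move=> x hx S [hS XS]; case: (hS) => _ _ _ h _; apply: h; apply: hx.
move=> x bx h S [hS XS]; case: (hS) => _ _ _ _ hc; apply: hc => // e e0.
by have [y Xy xy] := h e e0; exists y => //; apply: Xy.
Qed.

End OperatorNorm.

(** * Limits in the weak operator topology *)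

Section WeakLimits.
Context {R : realType} {H : hilbertType R}.
Implicit Types (F : nat -> H -> H) (T x y : H -> H).

Lemma WOT_cvgP F T : WOT_cvg F T <->
  forall xi eta : H, tends_to (fun n => ip (F n xi) eta) (ip (T xi) eta).
Proof.
split=> h xi eta.
  by have /(@tends_toP _ (R[i]^o)) := h xi eta.
by apply/(@tends_toP _ (R[i]^o)); exact: h.
Qed.

Lemma tends_to_unique (u : nat -> R[i]) a b :
  tends_to u a -> tends_to u b -> a = b.
Proof.
move=> h h'; apply/eqP; rewrite -subr_eq0; apply/eqP.
apply: nr_small_eq0 => e e0; have e2 : 0 < e / 2 by rewrite divr_gt0.
have [N hN] := h _ e2; have [N' hN'] := h' _ e2.
pose n := maxn N N'.
have {}hN := hN n (leq_maxl _ _); have {}hN' := hN' n (leq_maxr _ _).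
rewrite -(subrKA (u n)); apply: le_trans (ler_nrD _ _) _.
by rewrite nr_distC; lra.
Qed.

Lemma WOT_unique F T T' : WOT_cvg F T -> WOT_cvg F T' -> T = T'.
Proof.
move=> /WOT_cvgP h /WOT_cvgP h'; apply/funext => u; apply: ip_inj => z.
by rewrite ipC [RHS]ipC; congr _^*; exact: tends_to_unique (h u z) (h' u z).
Qed.

Lemma real_complete (u : nat -> R) :
  (forall e : R, 0 < e -> exists N, forall n m, (N <= n)%N -> (N <= m)%N ->
     `|u n - u m| <= e) ->
  exists l, forall e : R, 0 < e -> exists N, forall n, (N <= n)%N ->
    `|u n - l| <= e.
Proof.
move=> h.
suff /cvg_ex[l /cvgrPdist_le ul] : cvg (u @ \oo).
  exists l => e e0; have [N _ hN] := ul _ e0.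
  by exists N => n Nn; rewrite distrC; exact: hN.
apply/cauchy_cvgP/cauchy_ballP => e e0.
have e02 : 0 < e / 2 by rewrite divr_gt0.
have [N hN] := h _ e02.
exists ([set x | exists2 n, (N <= n)%N & x = u n],
        [set x | exists2 n, (N <= n)%N & x = u n]) => /=.
  by split; exists N => // n Nn /=; exists n.
move=> [x y] /= [[n Nn ->] [m Nm ->]].
rewrite -ball_normE /=; apply: le_lt_trans (hN _ _ Nn Nm) _.
by rewrite ltr_pdivrMr // ltr_pMr // ltr1n.
Qed.

Lemma nr_le_ReIm (c : R[i]) : nr c <= `|complex.Re c| + `|complex.Im c|.
Proof.
have -> : c = (complex.Re c)%:C + 'i%C * (complex.Im c)%:C.
  by case: c => a b; apply/eqP; rewrite eq_complex /=; apply/andP; split;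
    apply/eqP; ring.
apply: le_trans (ler_nrD _ _) _; rewrite nrM !nr_real /=.
rewrite !mul0r !mul1r !subr0 !add0r addr0.
rewrite lerD2l ler_piMl //.
by rewrite /nr normc_def /= expr0n add0r expr1n sqrtr1.
Qed.

Lemma Im_le_nr (c : R[i]) : `|complex.Im c| <= nr c.
Proof.
have -> : nr c = Num.sqrt (complex.Re c ^+ 2 + complex.Im c ^+ 2).
  by rewrite /nr normc_def.
by rewrite -sqrtr_sqr ler_wsqrtr // lerDr sqr_ge0.
Qed.

Lemma absRe_le_nr (c : R[i]) : `|complex.Re c| <= nr c.
Proof. by rewrite -lecR -nrE; exact: normc_ge_Re. Qed.

Lemma complex_complete (u : nat -> R[i]) :
  (forall e : R, 0 < e -> exists N, forall n m, (N <= n)%N -> (N <= m)%N ->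
     nr (u n - u m) <= e) ->
  exists l, tends_to u l.
Proof.
move=> h.
have ReB (a b : R[i]) : complex.Re (a - b) = complex.Re a - complex.Re b.
  by case: a b => ? ? [].
have ImB (a b : R[i]) : complex.Im (a - b) = complex.Im a - complex.Im b.
  by case: a b => ? ? [].
have [a ha] : exists l, forall e : R, 0 < e -> exists N, forall n, (N <= n)%N ->
    `|complex.Re (u n) - l| <= e.
  apply: real_complete => e /h[N hN]; exists N => n m Nn Nm.
  by rewrite -ReB (le_trans (absRe_le_nr _)) ?hN.
have [b hb] : exists l, forall e : R, 0 < e -> exists N, forall n, (N <= n)%N ->
    `|complex.Im (u n) - l| <= e.
  apply: real_complete => e /h[N hN]; exists N => n m Nn Nm.
  by rewrite -ImB (le_trans (Im_le_nr _)) ?hN.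
exists (a +i* b)%C => e e0; have e2 : 0 < e / 2 by rewrite divr_gt0.
have [N hN] := ha _ e2; have [N' hN'] := hb _ e2.
exists (maxn N N') => n; rewrite geq_max => /andP[/hN h1 /hN' h2].
apply: le_trans (nr_le_ReIm _) _; rewrite ReB ImB /=; lra.
Qed.

Lemma tends_to_le (u : nat -> R[i]) l (M : R) :
  tends_to u l -> (forall n, nr (u n) <= M) -> nr l <= M.
Proof.
move=> h hM; apply/ler_addgt0Pr => e /h[N /(_ N (leqnn N)) hN].
have := hM N; have := ler_nrD (u N) (l - u N).
by rewrite addrC subrK nr_distC; lra.
Qed.

Lemma WOT_bounded F T (M : R) : 0 <= M ->
  (forall n u, nr (F n u) <= M * nr u) -> WOT_cvg F T ->
  forall u, nr (T u) <= M * nr u.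
Proof.
move=> M0 hM /WOT_cvgP h u; apply: nr_le_ip; first by rewrite mulr_ge0 ?nr_ge0.
move=> v; apply: tends_to_le (h u v) _ => n.
apply: le_trans (cauchy_schwarz _ _) _.
by rewrite ler_wpM2r ?nr_ge0.
Qed.

Lemma WOT_lin F G S T (c : R[i]) : WOT_cvg F S -> WOT_cvg G T ->
  WOT_cvg (fun n => c *: F n + G n) (c *: S + T).
Proof.
move=> /WOT_cvgP h /WOT_cvgP h'; apply/WOT_cvgP => u v e e0.
have c0 : 0 < nr c + 1 by rewrite ltr_wpDl ?nr_ge0.
have e1 : 0 < e / 2 / (nr c + 1) by rewrite !divr_gt0.
have e2 : 0 < e / 2 by rewrite divr_gt0.
have [N hN] := h u v _ e1; have [N' hN'] := h' u v _ e2.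
exists (maxn N N') => n; rewrite geq_max => /andP[/hN h1 /hN' h2].
rewrite !fctE !ipDl !ipZl opprD addrACA -mulrBr.
apply: le_trans (ler_nrD _ _) _; rewrite nrM.
suff : nr c * nr (ip (F n u) v - ip (S u) v) <= e / 2 by lra.
apply: le_trans (_ : (nr c + 1) * nr (ip (F n u) v - ip (S u) v) <= _).
  by rewrite ler_wpM2r ?nr_ge0 // lerDl.
by move: h1; rewrite ler_pdivlMr // mulrC.
Qed.

Lemma WOT_linear F T : (forall n, linear (F n)) -> WOT_cvg F T -> linear T.
Proof.
move=> lF /WOT_cvgP h c u v; apply: ip_inj => z.
rewrite ipC [RHS]ipC; congr _^*.
apply: tends_to_unique (h _ z) _ => e e0.
have c0 : 0 < nr c + 1 by rewrite ltr_wpDl ?nr_ge0.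
have e1 : 0 < e / 2 / (nr c + 1) by rewrite !divr_gt0.
have e2 : 0 < e / 2 by rewrite divr_gt0.
have [N hN] := h u z _ e1; have [N' hN'] := h v z _ e2.
exists (maxn N N') => n; rewrite geq_max => /andP[/hN h1 /hN' h2].
rewrite lF !ipDl !ipZl opprD addrACA -mulrBr.
apply: le_trans (ler_nrD _ _) _; rewrite nrM.
suff : nr c * nr (ip (F n u) z - ip (T u) z) <= e / 2 by lra.
apply: le_trans (_ : (nr c + 1) * nr (ip (F n u) z - ip (T u) z) <= _).
  by rewrite ler_wpM2r ?nr_ge0 // lerDl.
by move: h1; rewrite ler_pdivlMr // mulrC.
Qed.

(** The limits of ip v (F n u) form a bounded linear functional of v, and the
    Riesz theorem turns it into the vector T u. *)
Lemma WOT_complete F (M : R) : 0 <= M -> (forall n, linear (F n)) ->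
  (forall n u, nr (F n u) <= M * nr u) ->
  (forall (u v : H) (e : R), 0 < e ->
    exists N, forall n m, (N <= n)%N -> (N <= m)%N ->
    nr (ip (F n u) v - ip (F m u) v) <= e) ->
  exists T, bounded_operators T /\ WOT_cvg F T.
Proof.
move=> M0 lF hM hC.
suff /choice[T hT] : forall u, exists w, forall v : H,
    tends_to (fun n => ip (F n u) v) (ip w v).
  have TW : WOT_cvg F T by apply/WOT_cvgP.
  exists T; split=> //; apply: (boundedI (WOT_linear lF TW) M0).
  exact: WOT_bounded TW.
move=> u.
have /choice[g hg] : forall v, exists l, tends_to (fun n => ip v (F n u)) l.
  move=> v; apply: complex_complete => e /(hC u v)[N hN].
  exists N => n m Nn Nm.
  by rewrite ipC [ip v (F m u)]ipC -rmorphB nr_conj hN.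
have gZ c v : g (c *: v) = c * g v.
  apply: tends_to_unique (hg _) _ => e e0.
  have c0 : 0 < nr c + 1 by rewrite ltr_wpDl ?nr_ge0.
  have e1 : 0 < e / (nr c + 1) by rewrite !divr_gt0.
  have [N hN] := hg v _ e1; exists N => n /hN h1.
  rewrite ipZl -mulrBr nrM.
  apply: le_trans (_ : (nr c + 1) * nr (ip v (F n u) - g v) <= _).
    by rewrite ler_wpM2r ?nr_ge0 // lerDl.
  by move: h1; rewrite ler_pdivlMr // mulrC.
have gD v w : g (v + w) = g v + g w.
  apply: tends_to_unique (hg _) _ => e e0.
  have e2 : 0 < e / 2 by rewrite divr_gt0.
  have [N hN] := hg v _ e2; have [N' hN'] := hg w _ e2.
  exists (maxn N N') => n; rewrite geq_max => /andP[/hN h1 /hN' h2].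
  rewrite ipDl opprD addrACA; apply: le_trans (ler_nrD _ _) _; lra.
have gM v : nr (g v) <= (M * nr u) * nr v.
  apply: tends_to_le (hg v) _ => n.
  by rewrite mulrC (le_trans (cauchy_schwarz _ _)) // ler_wpM2l ?nr_ge0.
have [w hw] := riesz_representation gD gZ gM.
exists w => v e /(hg v)[N hN]; exists N => n /hN.
by rewrite hw ipC [ip v w]ipC -rmorphB nr_conj.
Qed.

End WeakLimits.

(** * Commutants and von Neumann algebras *)

Section Commutants.
Context {R : realType} {H : hilbertType R}.
Implicit Types (S T x y : H -> H) (X Y M : set (H -> H)).

Lemma commutantS X Y : X `<=` Y -> commutant Y `<=` commutant X.
Proof. by move=> XY T [bT h]; split=> // x /XY; exact: h. Qed.

Lemma sub_bicommutant X : X `<=` bounded_operators ->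
  X `<=` commutant (commutant X).
Proof.
move=> Xb x Xx; split; first exact: Xb.
by move=> T [_ h]; rewrite h.
Qed.

Lemma commutant_bounded X : commutant X `<=` bounded_operators.
Proof. by move=> T []. Qed.

Lemma commutant3 X : X `<=` bounded_operators ->
  commutant (commutant (commutant X)) = commutant X.
Proof.
move=> Xb; apply/seteqP; split.
  exact/commutantS/sub_bicommutant.
exact/sub_bicommutant/commutant_bounded.
Qed.

Lemma commutant_adj X : X `<=` bounded_operators ->
  (forall x, X x -> X (adjoint x)) ->
  forall T, commutant X T -> commutant X (adjoint T).
Proof.
move=> Xb Xs T [bT h]; split; first exact: bounded_adj.
move=> x Xx; have bx := Xb _ Xx.
rewrite -{1}(adjointK bx) -(adjoint_comp (bounded_adj bx) bT) -h; last exact: Xs.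
by rewrite (adjoint_comp bT (bounded_adj bx)) adjointK.
Qed.

Lemma von_neumann_commutant X : X `<=` bounded_operators ->
  (forall x, X x -> X (adjoint x)) -> von_neumann_algebra (commutant X).
Proof.
by move=> Xb Xs; split; [exact: commutant_bounded | exact: commutant_adj |
  exact: commutant3].
Qed.

(** Commutation with x is tested against pairs of vectors, and there x moves to
    the second argument as its adjoint, so that it is a weakly closed
    condition. *)
Lemma commutant_WOT X (F : nat -> H -> H) T : X `<=` bounded_operators ->
  (exists N, forall n, (N <= n)%N -> commutant X (F n)) ->
  bounded_operators T -> WOT_cvg F T -> commutant X T.
Proof.
move=> Xb [N0 XF] bT /WOT_cvgP h; split=> // x Xx; have bx := Xb _ Xx.
apply/funext => u /=; apply: ip_inj => v; rewrite ipC [RHS]ipC; congr _^*.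
apply: tends_to_unique (h _ _) _ => e e0.
have [N hN] := h u (adjoint x v) _ e0; exists (maxn N N0) => n.
rewrite geq_max => /andP[/hN h1 /XF[_ /(_ _ Xx) /(congr1 (@^~ u)) /= ->]].
by rewrite !(adjointP bx).
Qed.

Lemma von_neumann_WOT M (F : nat -> H -> H) T : von_neumann_algebra M ->
  (exists N, forall n, (N <= n)%N -> M (F n)) ->
  bounded_operators T -> WOT_cvg F T -> M T.
Proof.
move=> [_ _ <-]; apply: commutant_WOT; exact: commutant_bounded.
Qed.

Lemma norm_limit_sequence X x :
  (forall e : R, 0 < e -> exists2 y, X y & opnorm (x - y) < e) ->
  exists F : nat -> H -> H, (forall n, X (F n)) /\
    (forall e : R, 0 < e -> exists N, forall n, (N <= n)%N ->
       opnorm (x - F n) <= e).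
Proof.
move=> h.
have /choice[F hF] n : exists y, X y /\ opnorm (x - y) < n.+1%:R^-1.
  have n0 : 0 < (n.+1%:R : R)^-1 by rewrite invr_gt0.
  by have [y] := h _ n0; exists y.
exists F; split=> [n|e e0]; first by case: (hF n).
have [N hN] := exists_invn_le e0; exists N => n /hN.
by apply: le_trans; case: (hF n) => _ /ltW.
Qed.

Lemma norm_limit_WOT (F : nat -> H -> H) x : bounded_operators x ->
  (forall n, bounded_operators (F n)) ->
  (forall e : R, 0 < e -> exists N, forall n, (N <= n)%N ->
       opnorm (x - F n) <= e) -> WOT_cvg F x.
Proof.
move=> bx bF h; apply/WOT_cvgP => u v e e0.
have c0 : 0 < nr u * nr v + 1 by rewrite ltr_wpDl ?mulr_ge0 ?nr_ge0.
have e1 : 0 < e / (nr u * nr v + 1) by rewrite !divr_gt0.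
have [N hN] := h _ e1; exists N => n /hN h1.
rewrite -ipBl; apply: le_trans (cauchy_schwarz _ _) _; rewrite nr_distC.
have b := boundedB bx (bF n).
have h2 : nr (x u - F n u) <= opnorm (x - F n) * nr u := opnormP u b.
apply: le_trans (_ : opnorm (x - F n) * (nr u * nr v + 1) <= _).
  rewrite mulrDr mulr1 mulrA; apply: ler_wpDr; first exact: opnorm_ge0.
  by rewrite ler_wpM2r ?nr_ge0.
by rewrite -ler_pdivlMr.
Qed.

Lemma von_neumann_op_cstar M : von_neumann_algebra M -> op_cstar_subalgebra M.
Proof.
move=> vM; have [Mb Ms M2] := vM.
split=> //.
- rewrite -M2; split=> [|c x y [bx hx] [by_ hy]].
    split; first exact: bounded0.
    move=> T [bT _]; apply/funext => u /=.
    by have [-> _ _ _] := bounded_linear bT.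
  split; first exact: bounded_lin.
  by move=> T hT; rewrite comp_linl comp_linr ?hx ?hy //; case: hT.
- rewrite -M2 => x y [bx hx] [by_ hy]; split; first exact: bounded_comp.
  by move=> T hT; rewrite -compA hy // compA hx.
move=> x bx /norm_limit_sequence[F [MF Fx]].
apply: (von_neumann_WOT (F := F) vM) => //; first by exists 0%N.
apply: norm_limit_WOT => // n; exact: Mb.
Qed.

(** Bicommutants are monotone, so an intersection of algebras that equal their
    bicommutant equals its own. *)
Lemma von_neumann_Wstar X : X `<=` bounded_operators ->
  von_neumann_algebra (Wstar X).
Proof.
move=> Xb.
have vB : von_neumann_algebra (commutant (set0 : set (H -> H))).
  by apply: von_neumann_commutant.
have B0 : commutant (set0 : set (H -> H)) = bounded_operators.
  by apply/seteqP; split=> [T []//|T bT]; split.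
have WM M : von_neumann_algebra M -> X `<=` M -> Wstar X `<=` M.
  by move=> vM XM x; apply.
have Wb : Wstar X `<=` bounded_operators by apply: WM; rewrite -?B0 // B0.
split=> //.
  move=> x hx M [vM XM]; case: (vM) => _ h _; apply: h; exact: hx.
apply/seteqP; split; last exact: sub_bicommutant.
move=> x hx M [vM XM]; case: (vM) => Mb _ <-.
by move: hx; do 2!apply: commutantS; exact: WM.
Qed.

Lemma Wstar_min X M : von_neumann_algebra M -> X `<=` M -> Wstar X `<=` M.
Proof. by move=> vM XM x; apply. Qed.

Lemma Wstar_gen X : X `<=` Wstar X.
Proof. exact: sub_gen_smallest. Qed.

End Commutants.

(** * Star representations are contractive *)

(** What square roots and representations use of a unital Banach star algebra,
    for a subset D of an ambient module and explicit operations. This covers at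
    once a C*-algebra with its ring product and a C*-algebra of operators, which
    lives in the pointwise module of all maps from H to H and has composition as
    product. Completeness is stated for sequences with geometric steps, such as
    the iterates of a contraction. *)
Record complete_star_algebra {R : realType} {E : lmodType R[i]} (D : set E)
    (one : E) (mul : E -> E -> E) (st : E -> E) (N : E -> R) : Prop := {
  csa_one : D one;
  csa_lin : forall (c : R[i]) x y, D x -> D y -> D (c *: x + y);
  csa_mul : forall x y, D x -> D y -> D (mul x y);
  csa_st : forall x, D x -> D (st x);
  csa_mul_linl : forall (c : R[i]) x y z, D x -> D y -> D z ->
    mul (c *: x + y) z = c *: mul x z + mul y z;
  csa_mul_linr : forall (c : R[i]) x y z, D x -> D y -> D z ->
    mul z (c *: x + y) = c *: mul z x + mul z y;
  csa_mul1l : forall x, D x -> mul one x = x;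
  csa_mul1r : forall x, D x -> mul x one = x;
  csa_st_lin : forall (c : R[i]) x y, D x -> D y ->
    st (c *: x + y) = c^* *: st x + st y;
  csa_st_mul : forall x y, D x -> D y -> st (mul x y) = mul (st y) (st x);
  csa_stK : forall x, D x -> st (st x) = x;
  csa_st1 : st one = one;
  csa_norm_ge0 : forall x, D x -> 0 <= N x;
  csa_norm_eq0 : forall x, D x -> N x = 0 -> x = 0;
  csa_normD : forall x y, D x -> D y -> N (x + y) <= N x + N y;
  csa_normZ : forall (c : R[i]) x, D x -> N (c *: x) <= nr c * N x;
  csa_normM : forall x y, D x -> D y -> N (mul x y) <= N x * N y;
  csa_norm_st : forall x, D x -> N (st x) <= N x;
  csa_complete : forall (u : nat -> E) (q C : R), 0 <= q -> q < 1 -> 0 <= C ->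
    (forall n, D (u n)) -> (forall n, N (u n.+1 - u n) <= q ^+ n * C) ->
    exists2 l, D l & forall e : R, 0 < e ->
      exists K, forall n, (K <= n)%N -> N (u n - l) <= e
}.

Section SquareRoot.
Context {R : realType} {E : lmodType R[i]} (D : set E) (one : E)
  (mul : E -> E -> E) (st : E -> E) (N : E -> R).
Hypothesis alg : complete_star_algebra D one mul st N.

Let D0 : D 0.
Proof.
by rewrite -(addNr one) -scaleN1r; apply: (csa_lin alg); exact: (csa_one alg).
Qed.

Let DD x y : D x -> D y -> D (x + y).
Proof. by move=> Dx Dy; rewrite -[x]scale1r; exact: (csa_lin alg). Qed.

Let DZ c x : D x -> D (c *: x).
Proof. by move=> Dx; rewrite -[_ *: _]addr0; exact: (csa_lin alg). Qed.

Let DB x y : D x -> D y -> D (x - y).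
Proof. by move=> Dx Dy; rewrite addrC -scaleN1r; exact: (csa_lin alg). Qed.

Let mulBl x y z : D x -> D y -> D z -> mul (x - y) z = mul x z - mul y z.
Proof.
by move=> Dx Dy Dz; rewrite addrC -scaleN1r (csa_mul_linl alg) // scaleN1r addrC.
Qed.

Let mulBr x y z : D x -> D y -> D z -> mul z (x - y) = mul z x - mul z y.
Proof.
by move=> Dx Dy Dz; rewrite addrC -scaleN1r (csa_mul_linr alg) // scaleN1r addrC.
Qed.

Let NZr (r : R) x : D x -> 0 <= r -> N (r%:C *: x) <= r * N x.
Proof.
move=> Dx r0; apply: le_trans (csa_normZ alg _ Dx) _.
by rewrite nr_real ger0_norm.
Qed.

Let N0 : N 0 = 0.
Proof.
apply/eqP; rewrite eq_le (csa_norm_ge0 alg D0) andbT.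
by have := csa_normZ alg 0 D0; rewrite scale0r nr0 mul0r.
Qed.

Let NB x y : D x -> D y -> N (x - y) <= N (y - x).
Proof.
move=> Dx Dy; rewrite -(opprB y x) -[X in N X <= _]scaleN1r.
by apply: le_trans (csa_normZ alg _ (DB Dy Dx)) _; rewrite nrN nr1 mul1r.
Qed.

Let stB x y : D x -> D y -> st (x - y) = st x - st y.
Proof.
move=> Dx Dy; rewrite addrC -scaleN1r (csa_st_lin alg) //.
by rewrite rmorphN1 scaleN1r addrC.
Qed.

Let DM := csa_mul alg.

Let square_diff x y : D x -> D y ->
  mul x x - mul y y = mul x (x - y) + mul (x - y) y.
Proof. by move=> Dx Dy; rewrite mulBr // mulBl // addrA subrK. Qed.

Let N_square_diff (r : R) x y : D x -> D y -> N x <= r -> N y <= r ->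
  N (mul x x - mul y y) <= 2 * r * N (x - y).
Proof.
move=> Dx Dy xr yr; rewrite square_diff //.
have Dxy := DB Dx Dy; have Nxy := csa_norm_ge0 alg Dxy.
apply: le_trans (csa_normD alg _ _) _; try exact: DM.
have h1 := csa_normM alg Dx Dxy; have h2 := csa_normM alg Dxy Dy.
have := ler_wpM2r Nxy xr; have := ler_wpM2l Nxy yr; lra.
Qed.

Variable a : E.
Hypotheses (Da : D a) (sta : st a = a) (Na : N a < 1).

(** A fixed point t of this map satisfies mul (one - t) (one - t) = one - a. *)
Let phi x := (2^-1)%:C *: (a + mul x x).
Let t n := iter n phi 0.

Let half0 : 0 <= 2^-1 :> R. Proof. by rewrite invr_ge0. Qed.

Let Dphi x : D x -> D (phi x).
Proof. by move=> Dx; apply/DZ/DD => //; exact: DM. Qed.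

Let q0 : 0 <= N a. Proof. exact: (csa_norm_ge0 alg). Qed.

Let phi_diff (r : R) x y : D x -> D y -> N x <= r -> N y <= r ->
  N (phi x - phi y) <= r * N (x - y).
Proof.
move=> Dx Dy xr yr; rewrite /phi -scalerBr opprD addrACA subrr add0r.
apply: le_trans (NZr _ half0) _; first by apply: DB; exact: DM.
have := N_square_diff Dx Dy xr yr; lra.
Qed.

Let Dt n : D (t n).
Proof. by elim: n => [|n ih] //=; exact: Dphi. Qed.

Let Nt n : N (t n) <= N a.
Proof.
elim: n => [|n ih] /=; first by rewrite N0.
apply: le_trans (NZr _ half0) _; first by apply: DD => //; exact: DM.
have := csa_normD alg Da (DM (Dt n) (Dt n)).
have := csa_normM alg (Dt n) (Dt n).
have t0 := csa_norm_ge0 alg (Dt n).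
have : N (t n) * N (t n) <= N a * 1.
  by rewrite ler_pM // (ltW (le_lt_trans ih Na)).
lra.
Qed.

Let st_t n : st (t n) = t n.
Proof.
elim: n => [|n ih] /=.
  by rewrite -(subrr one) stB ?subrr //; exact: csa_one alg.
rewrite /phi -[_ *: _]addr0 (csa_st_lin alg) // ?conj_real; last first.
  by apply: DD => //; exact: DM.
have st0 : st 0 = 0.
  by rewrite -(subrr one) stB ?subrr //; exact: csa_one alg.
rewrite st0 -[a + _]/(a + mul (t n) (t n)) -{1}[a]scale1r.
rewrite (csa_st_lin alg) //; last exact: DM.
by rewrite conjC1 scale1r sta (csa_st_mul alg) // -/(t n) ih.
Qed.

Let t_step n : N (t n.+1 - t n) <= N a ^+ n * N a.
Proof.
elim: n => [|n ih].
  rewrite expr0 mul1r subr0; exact: (Nt 1).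
rewrite exprS -mulrA; have h := phi_diff (Dt n.+1) (Dt n) (Nt _) (Nt _).
by apply: (le_trans h); exact: ler_wpM2l.
Qed.

(** With s = one - t, the equation becomes t = (a + t ^ 2) / 2. The right-hand
    side preserves the ball of radius N a, contracts it with ratio N a < 1, and
    preserves self-adjointness; so its iterates from 0 converge to a
    self-adjoint solution. *)
Lemma square_root : exists s, [/\ D s, st s = s & mul s s = one - a].
Proof.
have [l Dl tl] := csa_complete alg q0 Na q0 Dt t_step.
have D1 := csa_one alg.
have Nl := csa_norm_ge0 alg Dl.
have lphi : l = phi l.
  apply/eqP; rewrite -subr_eq0; apply/eqP.
  have Dlp := DB Dl (Dphi Dl).
  apply: (csa_norm_eq0 alg) => //.
  apply/eqP; rewrite eq_le (csa_norm_ge0 alg Dlp) andbT.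
  apply/ler_addgt0Pr => e e0; rewrite add0r.
  set r := N a + N l.
  have r0 : 0 <= r by rewrite addr_ge0.
  have r1 : 0 < 1 + r by rewrite ltr_wpDr.
  have e1 : 0 < e / (1 + r) by rewrite divr_gt0.
  have [K hK] := tl _ e1.
  have h1 := hK K.+1 (leqnSn K); have h2 := hK K (leqnn K).
  rewrite -(subrKA (t K.+1)).
  apply: le_trans (csa_normD alg (DB Dl (Dt _)) (DB (Dt _) (Dphi Dl))) _.
  have h3 : N (t K.+1 - phi l) <= r * N (t K - l).
    apply: phi_diff => //; rewrite /r; last by rewrite lerDr.
    by rewrite (le_trans (Nt K)) // lerDl.
  have h4 := NB Dl (Dt K.+1).
  have h5 : r * N (t K - l) <= r * (e / (1 + r)) by rewrite ler_wpM2l.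
  rewrite (_ : e = e / (1 + r) + r * (e / (1 + r))); first by lra.
  by field; rewrite gt_eqF.
have stl : st l = l.
  apply/eqP; rewrite -subr_eq0; apply/eqP.
  have Dsl := DB (csa_st alg Dl) Dl.
  apply: (csa_norm_eq0 alg) => //.
  apply/eqP; rewrite eq_le (csa_norm_ge0 alg Dsl) andbT.
  apply/ler_addgt0Pr => e e0; rewrite add0r.
  have e2 : 0 < e / 2 by rewrite divr_gt0.
  have [K /(_ K (leqnn K)) hK] := tl _ e2.
  rewrite -(subrKA (t K)).
  apply: le_trans (csa_normD alg (DB (csa_st alg Dl) (Dt K)) (DB (Dt K) Dl)) _.
  have -> : st l - t K = st (l - t K) by rewrite stB // st_t.
  have := csa_norm_st alg (DB Dl (Dt K)); have := NB Dl (Dt K); lra.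
exists (one - l); split; first exact: DB.
  by rewrite stB // (csa_st1 alg) stl.
rewrite mulBl // ?mulBr //; try exact: DB.
rewrite !(csa_mul1l alg) // (csa_mul1r alg) //.
have ll : l + l = a + mul l l.
  rewrite {1 2}lphi -scalerDl -rmorphD /= -(mulr1 2^-1) -mulrDr.
  by rewrite mulVf ?pnatr_eq0 // scale1r.
have -> : a = l + (l - mul l l) by rewrite addrA ll addrK.
by rewrite [in RHS]opprD addrA.
Qed.

End SquareRoot.

Section Contractive.
Context {R : realType} {H : hilbertType R} {E : lmodType R[i]}.
Variables (D : set E) (one : E) (mul : E -> E -> E) (st : E -> E) (N : E -> R).

Record star_rep (Phi : E -> H -> H) : Prop := {
  star_rep_bounded : forall x, D x -> bounded_operators (Phi x);
  star_rep_lin : forall (c : R[i]) x y, D x -> D y ->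
    Phi (c *: x + y) = c *: Phi x + Phi y;
  star_rep_mul : forall x y, D x -> D y -> Phi (mul x y) = Phi x \o Phi y;
  star_rep_one : Phi one = idfun;
  star_rep_adj : forall x, D x -> is_adjoint (Phi x) (Phi (st x))
}.

Variable Phi : E -> H -> H.
Hypotheses (alg : complete_star_algebra D one mul st N) (rep : star_rep Phi).

(** If N y < 1, then one - mul (st y) y is the square of a self-adjoint s.
    Applying Phi, the number nr u ^+ 2 - nr (Phi y u) ^+ 2 equals
    nr (Phi s u) ^+ 2, hence is nonnegative. In particular the continuity of
    star representations is automatic. *)
Lemma star_rep_contractive x u : D x -> nr (Phi x u) <= N x * nr u.
Proof.
have lt1 y : D y -> N y < 1 -> nr (Phi y u) <= nr u.
  move=> Dy Ny; have Dsy := csa_st alg Dy; have Na0 := csa_norm_ge0 alg Dy.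
  have Da := csa_mul alg Dsy Dy.
  have [s [Ds sts ss]] :
      exists s, [/\ D s, st s = s & mul s s = one - mul (st y) y].
    apply: (square_root alg Da).
      by rewrite (csa_st_mul alg) // (csa_stK alg).
    apply: le_lt_trans (csa_normM alg Dsy Dy) _.
    have := csa_norm_st alg Dy; have := csa_norm_ge0 alg Dsy; nra.
  have : ip (Phi (mul s s) u) u = ip u u - ip (Phi y u) (Phi y u).
    rewrite ss [one - _]addrC -scaleN1r (star_rep_lin rep) //; last first.
      exact: csa_one alg.
    rewrite !fctE (star_rep_one rep) scaleN1r addrC (star_rep_mul rep) //= ipBl.
    congr (_ - _); rewrite (star_rep_adj rep Dsy) (csa_stK alg) //.
  rewrite (star_rep_mul rep) //= (star_rep_adj rep) // sts !ipxx -rmorphB.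
  move=> /(@complexI R) h.
  rewrite -(@ler_pXn2r _ 2) // ?nnegrE ?nr_ge0 // -subr_ge0 -h; exact: sqr_ge0.
move=> Dx; have Nx := csa_norm_ge0 alg Dx.
apply/ler_addgt0Pr => e e0.
have u1 : 0 < nr u + 1 by rewrite ltr_wpDl ?nr_ge0.
(* The slack d brings the norm of x / (N x + d) strictly below 1. *)
pose d := e / (nr u + 1); have d0 : 0 < d by rewrite divr_gt0.
have Nd : 0 < N x + d by rewrite ltr_wpDl.
have c0 : 0 <= (N x + d)^-1 by rewrite invr_ge0 ltW.
have := lt1 ((N x + d)^-1%:C *: x).
have D0 : D 0.
  by rewrite -(addNr one) -scaleN1r; apply: (csa_lin alg); exact: (csa_one alg).
have P0 : Phi 0 = 0.
  have := star_rep_lin rep (-1) (csa_one alg) (csa_one alg).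
  by rewrite !scaleN1r !addNr.
have -> : Phi ((N x + d)^-1%:C *: x) = (N x + d)^-1%:C *: Phi x.
  by rewrite -[X in Phi X]addr0 (star_rep_lin rep) // P0 addr0.
rewrite !fctE nrZ nr_real ger0_norm // [_ * nr _]mulrC ler_pdivrMr // => h.
apply: le_trans (h _ _) _.
- by rewrite -[_ *: _]addr0; exact: (csa_lin alg).
- apply: le_lt_trans (csa_normZ alg _ Dx) _.
  by rewrite nr_real ger0_norm // mulrC ltr_pdivrMr // mul1r ltrDl.
rewrite mulrDr mulrC lerD2l /d mulrA ler_pdivrMr //.
by rewrite mulrC ler_wpM2l ?(ltW e0) // lerDl.
Qed.

End Contractive.

(** * C*-algebras as complete star algebras *)

Section Completeness.
Context {R : realType}.

Lemma geometric_small (q C e : R) : 0 <= q -> q < 1 -> 0 < e ->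
  exists K, forall n, (K <= n)%N -> q ^+ n * C <= e.
Proof.
move=> q0 q1 e0.
have C0 : 0 < `|C| + 1 by rewrite ltr_wpDl.
have : (fun n => q ^+ n) @ \oo --> (0 : R).
  by apply: cvg_expr; rewrite ger0_norm.
move=> /cvgrPdist_le/(_ (e / (`|C| + 1)))[|K _ hK]; first by rewrite divr_gt0.
exists K => n /hK; rewrite sub0r normrN ger0_norm ?exprn_ge0 // ler_pdivlMr //.
apply: le_trans; apply: ler_wpM2l; first exact: exprn_ge0.
by rewrite (le_trans (ler_norm _)) // lerDl.
Qed.

(** The explicit rate is what makes pointwise limits of operators uniform on the
    unit ball. *)
Lemma geometric_limit (V : completeNormedModType R[i]) (u : nat -> V) (q C : R) :
  0 <= q -> q < 1 -> 0 <= C ->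
  (forall n, nr (u n.+1 - u n) <= q ^+ n * C) ->
  exists l, forall n, nr (u n - l) <= q ^+ n * (C / (1 - q)).
Proof.
move=> q0 q1 C0 hu; have q1' : 0 < 1 - q by rewrite subr_gt0.
have D0 : 0 <= C / (1 - q) by rewrite divr_ge0 // ltW.
have tail n k : nr (u n - u (n + k)%N) <= q ^+ n * (C / (1 - q)).
  suff : nr (u n - u (n + k)%N) <= (q ^+ n - q ^+ (n + k)) * (C / (1 - q)).
    move/le_trans; apply; rewrite ler_wpM2r // gerBl exprn_ge0 //.
  elim: k => [|k ih]; first by rewrite addn0 !subrr nr0 mul0r.
  rewrite -(subrKA (u (n + k)%N)); apply: le_trans (ler_nrD _ _) _.
  have := hu (n + k)%N; rewrite -addnS nr_distC => h.
  rewrite -[X in _ <= X * _](subrKA (q ^+ (n + k))) mulrDl lerD //.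
  apply: le_trans h _; rewrite addnS exprSr le_eqVlt; apply/orP; left.
  by apply/eqP; field; rewrite gt_eqF.
have [l hl] : exists l : V, tends_to u l.
  apply: nr_complete => e e0; have e2 : 0 < e / 2 by rewrite divr_gt0.
  have [K hK] := geometric_small (C / (1 - q)) q0 q1 e2.
  exists K => n m Kn Km; rewrite -(subrKA (u K)); apply: le_trans (ler_nrD _ _) _.
  have := tail K (n - K)%N; have := tail K (m - K)%N; rewrite !subnKC //.
  rewrite [nr (u n - u K)]nr_distC; have := hK K (leqnn K); lra.
exists l => n; apply/ler_addgt0Pr => e /hl[N hN].
have := hN (n + N)%N (leq_addl _ _); have := tail n N => h1 h2.
by rewrite -(subrKA (u (n + N)%N)); apply: le_trans (ler_nrD _ _) _; lra.
Qed.

End Completeness.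

Section CStarNorm.
Context {R : realType} {A : cstarAlgType R}.
Implicit Types a b : A.

Lemma star1 : star (1 : A) = 1.
Proof.
have h : star (star (1 : A) * 1) = star 1 * star (star 1) by exact: star_mul.
by move: h; rewrite mulr1 !starK mulr1.
Qed.

Lemma nr_mul a b : nr (a * b) <= nr a * nr b.
Proof.
rewrite -lecR rmorphM /= -!nrE; exact: cstar_norm_mul.
Qed.

Lemma nr_star_mul a : nr (star a * a) = nr a ^+ 2.
Proof.
apply: (@complexI R); rewrite rmorphXn /= -!nrE; exact: cstar_norm_star.
Qed.

Lemma nr_star_le a : nr a <= nr (star a).
Proof.
have [->|na] := eqVneq (nr a) 0; first exact: nr_ge0.
have a0 : 0 < nr a by rewrite lt_neqAle nr_ge0 eq_sym na.
rewrite -(ler_pM2r a0) -expr2 -nr_star_mul; exact: nr_mul.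
Qed.

Lemma nr_star a : nr (star a) = nr a.
Proof.
apply/eqP; rewrite eq_le nr_star_le andbT.
by have := nr_star_le (star a); rewrite starK.
Qed.

Lemma cstar_complete_star_algebra :
  @complete_star_algebra R A setT 1 *%R (@star R A) nr.
Proof.
split=> //.
- by move=> c x y z _ _ _; rewrite mulrDl scalerAl.
- by move=> c x y z _ _ _; rewrite mulrDr scalerAr.
- by move=> x _; rewrite mul1r.
- by move=> x _; rewrite mulr1.
- by move=> c x y _ _; rewrite starD starZ.
- by move=> x y _ _; exact: star_mul.
- by move=> x _; exact: starK.
- exact: star1.
- by move=> x _; exact: nr_ge0.
- by move=> x _; exact: nr0_eq0.
- by move=> x y _ _; exact: ler_nrD.
- by move=> c x _; rewrite nrZ.
- by move=> x y _ _; exact: nr_mul.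
- by move=> x _; rewrite nr_star.
move=> u q C q0 q1 C0 _ /(geometric_limit q0 q1 C0)[l hl].
exists l => // e e0; have [K hK] := geometric_small (C / (1 - q)) q0 q1 e0.
by exists K => n /hK; apply: le_trans.
Qed.

End CStarNorm.

Section OperatorAlgebra.
Context {R : realType} {H : hilbertType R} (S : set (H -> H)).
Hypotheses (cS : op_cstar_subalgebra S) (S1 : S idfun).

(** A sequence of operators with geometric steps converges pointwise at a rate
    that is uniform on the unit ball; so it converges in norm, and the limit
    stays in S. *)
Lemma operator_complete_star_algebra :
  @complete_star_algebra R (H -> H) S idfun (fun x y => x \o y)
    (@adjoint R H) (@opnorm R H).
Proof.
have [Sb [S0 Sl] SM Ss Sc] := cS.
split=> //.
- by move=> c x y z _ _ /Sb bz; exact: comp_linr.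
- by move=> c x y /Sb bx /Sb by_; exact: adjoint_lin.
- by move=> x y /Sb bx /Sb by_; exact: adjoint_comp.
- by move=> x /Sb; exact: adjointK.
- exact: adjoint_id.
- by move=> x /Sb; exact: opnorm_ge0.
- by move=> x /Sb; exact: opnorm_eq0.
- by move=> x y /Sb bx /Sb; exact: opnormD.
- by move=> c x /Sb; exact: opnormZ_le.
- by move=> x y /Sb bx /Sb; exact: opnormM.
- by move=> x /Sb; exact: opnorm_adj.
move=> u q C q0 q1 C0 Su hu; have q1' : 0 < 1 - q by rewrite subr_gt0.
have D0 : 0 <= C / (1 - q) by rewrite divr_ge0 // ltW.
have bu n : bounded_operators (u n) by exact: Sb.
have /choice[l hl] v : exists w, forall n,
    nr (u n v - w) <= q ^+ n * (C / (1 - q)) * nr v.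
  have [w hw] : exists w, forall n,
      nr (u n v - w) <= q ^+ n * (C * nr v / (1 - q)).
    apply: geometric_limit => // [|n]; first by rewrite mulr_ge0 ?nr_ge0.
    have := opnormP v (boundedB (bu n.+1) (bu n)).
    move/le_trans; apply; rewrite mulrA ler_wpM2r ?nr_ge0 //.
  by exists w => n; rewrite -mulrA (mulrAC C).
have uW : WOT_cvg u l.
  apply/WOT_cvgP => v w e e0.
  have [K hK] := geometric_small (C / (1 - q) * nr v * nr w) q0 q1 e0.
  exists K => n /hK; apply: le_trans; rewrite -ipBl.
  apply: le_trans (cauchy_schwarz _ _) _; rewrite !mulrA ler_wpM2r ?nr_ge0 //.
  by rewrite (le_trans (hl _ _)) // !mulrA.
have ll : linear l by apply: (WOT_linear _ uW) => n; case: (bu n).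
have bl : bounded_operators l.
  apply: (@boundedI _ _ _ (opnorm (u 0%N) + C / (1 - q))) => //.
    by rewrite addr_ge0 // opnorm_ge0.
  move=> v; rewrite -(subrK (u 0%N v) (l v)) addrC.
  apply: le_trans (ler_nrD _ _) _.
  rewrite mulrDl lerD ?opnormP // nr_distC.
  by have := hl v 0%N; rewrite expr0 mul1r.
have dist n : opnorm (u n - l) <= q ^+ n * (C / (1 - q)).
  by apply: opnorm_le; [rewrite mulr_ge0 // exprn_ge0 | move=> v; exact: hl].
exists l; last first.
  move=> e e0; have [K hK] := geometric_small (C / (1 - q)) q0 q1 e0.
  by exists K => n /hK; apply: le_trans.
apply: Sc => // e e0; have e2 : 0 < e / 2 by rewrite divr_gt0.
have [K /(_ K (leqnn K)) hK] := geometric_small (C / (1 - q)) q0 q1 e2.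
exists (u K) => //.
have -> : l - u K = (-1) *: (u K - l) + 0 by rewrite scaleN1r opprB addr0.
rewrite addr0; apply: le_lt_trans (opnormZ_le _ (boundedB (bu K) bl)) _.
rewrite nrN nr1 mul1r; have := dist K; lra.
Qed.

End OperatorAlgebra.

(** * Representations of C*-algebras of operators *)

Local Notation op_star_rep S :=
  (star_rep S idfun (fun x y => x \o y) (@adjoint _ _)).

Section OperatorRepresentations.
Context {R : realType} {H : hilbertType R} (S : set (H -> H)).
Hypotheses (cS : op_cstar_subalgebra S) (S1 : S idfun).
Variable Phi : (H -> H) -> H -> H.
Hypothesis rep : op_star_rep S Phi.

Lemma op_star_rep_contractive x u : S x -> nr (Phi x u) <= opnorm x * nr u.
Proof. exact: (star_rep_contractive (operator_complete_star_algebra cS S1)). Qed.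

Lemma op_star_rep_norm x : S x -> opnorm (Phi x) <= opnorm x.
Proof.
move=> Sx; apply: opnorm_le => [|u]; last exact: op_star_rep_contractive.
by apply: opnorm_ge0; case: cS => Sb _ _ _ _; exact: Sb.
Qed.

Lemma op_star_repB x y : S x -> S y -> Phi (x - y) = Phi x - Phi y.
Proof. by move=> Sx Sy; rewrite -!scaleN1_add (star_rep_lin rep). Qed.

Lemma op_star_rep0 : Phi 0 = 0.
Proof. by have := op_star_repB S1 S1; rewrite !subrr. Qed.

(** Reduces the inclusion of the image of a generated C*-algebra in S' to a
    check on generators. Norm closedness comes from contractivity. *)
Lemma op_star_rep_preimage (S' : set (H -> H)) : op_cstar_subalgebra S' ->
  op_cstar_subalgebra [set x | S x /\ S' (Phi x)].
Proof.
move=> [Sb' [S0' Sl'] SM' Ss' Sc']; have [Sb [S0 Sl] SM Ss Sc] := cS; split.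
- by move=> x [Sx _]; exact: Sb.
- split; first by split; rewrite ?op_star_rep0.
  move=> c x y [Sx Sx'] [Sy Sy']; split; first exact: Sl.
  by rewrite (star_rep_lin rep) //; exact: Sl'.
- move=> x y [Sx Sx'] [Sy Sy']; split; first exact: SM.
  by rewrite (star_rep_mul rep) //; exact: SM'.
- move=> x [Sx Sx']; split; first exact: Ss.
  by rewrite -(adjointE (star_rep_adj rep Sx)); exact: Ss'.
move=> x bx h; have Sx : S x by apply: Sc => // e /h[y [Sy _] xy]; exists y.
split=> //; apply: Sc'; first exact: (star_rep_bounded rep).
move=> e /h[y [Sy Sy'] xy]; exists (Phi y) => //.
rewrite -op_star_repB //; apply: le_lt_trans (op_star_rep_norm _) xy.
exact: op_cstarB.
Qed.

End OperatorRepresentations.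

Section RepresentationComposition.
Context {R : realType} {H : hilbertType R} (S : set (H -> H)).

Lemma op_star_rep_id : S `<=` bounded_operators -> op_star_rep S id.
Proof. by move=> Sb; split=> // x /Sb; exact: adjointP. Qed.

Lemma op_star_rep_comp (Phi Theta : (H -> H) -> H -> H) :
  (forall x, S x -> S (Theta x)) ->
  op_star_rep S Theta -> op_star_rep S Phi -> op_star_rep S (Phi \o Theta).
Proof.
move=> ST rT rP; split.
- by move=> x Sx; apply: (star_rep_bounded rP); exact: ST.
- by move=> c x y Sx Sy /=; rewrite (star_rep_lin rT) // (star_rep_lin rP) //;
    exact: ST.
- by move=> x y Sx Sy /=; rewrite (star_rep_mul rT) // (star_rep_mul rP) //;
    exact: ST.
- by rewrite /= (star_rep_one rT) (star_rep_one rP).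
move=> x Sx /=; rewrite -(adjointE (star_rep_adj rT Sx)).
by apply: (star_rep_adj rP); exact: ST.
Qed.

End RepresentationComposition.

Section Unitaries.
Context {R : realType} {H : hilbertType R} (V : H -> H).
Hypothesis uV : unitary V.

Lemma unitary_bounded : bounded_operators V. Proof. by case: uV. Qed.

Lemma adj_unitaryK u : adjoint V (V u) = u.
Proof. by case: uV => _ /(congr1 (@^~ u)). Qed.

Lemma unitary_adjK u : V (adjoint V u) = u.
Proof. by case: uV => _ _ /(congr1 (@^~ u)). Qed.

Lemma unitary_norm u : nr (V u) = nr u.
Proof.
apply/eqP; rewrite -(@eqrXn2 _ 2) ?nr_ge0 //; apply/eqP.
have := congr1 (@complex.Re R) (adjointP unitary_bounded u (V u)).
by rewrite adj_unitaryK !ipxx.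
Qed.

Lemma conj_by_bounded x : bounded_operators x -> bounded_operators (conj_by V x).
Proof.
move=> bx; have bV := unitary_bounded.
by apply: bounded_comp; [exact: bounded_comp | exact: bounded_adj].
Qed.

Lemma conj_by_rep (S : set (H -> H)) : S `<=` bounded_operators ->
  op_star_rep S (conj_by V).
Proof.
move=> Sb; have bV := unitary_bounded; have [V0 VD VZ _] := bounded_linear bV.
split.
- by move=> x /Sb; exact: conj_by_bounded.
- by move=> c x y _ _; apply/funext => u; rewrite /conj_by !fctE /= VD VZ.
- by move=> x y _ _; apply/funext => u; rewrite /conj_by /= adj_unitaryK.
- by apply/funext => u; rewrite /conj_by /= unitary_adjK.
move=> x /Sb bx u v; rewrite /conj_by /=.
by rewrite (adjointP bV) (adjointP bx) -(is_adjoint_sym (adjointP bV)).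
Qed.

Lemma conj_by_fixed x : bounded_operators x ->
  (conj_by V x = x <-> V \o x = x \o V).
Proof.
move=> bx; rewrite /conj_by; split=> h.
  apply/funext => u; have := congr1 (@^~ (V u)) h.
  by rewrite /= adj_unitaryK.
by rewrite h; apply/funext => u /=; rewrite unitary_adjK.
Qed.

End Unitaries.

(** * The GNS representation and its symmetries *)

Section GNSRepresentation.
Context {R : realType} {A AA : cstarAlgType R} (lam : nat -> A -> AA).
Hypothesis lam_free : is_free_power lam.
Context (psi : AA -> R[i]) {H : hilbertType R} (hat : AA -> H)
  (pi : AA -> H -> H).
Hypothesis gns : is_GNS hat pi psi.

Let pib a : bounded_operators (pi a). Proof. by case: gns. Qed.
Let pih a b : pi a (hat b) = hat (a * b). Proof. by case: gns. Qed.
Let hatip a b : ip (hat a) (hat b) = psi (star b * a). Proof. by case: gns. Qed.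

Lemma hat_dense u e : 0 < e -> exists a, nr (hat a - u) <= e.
Proof.
have [_ dh _ _ _] := gns => e0.
by have [_ [a _ <-] h] := dense_nr dh u e0; exists a.
Qed.

Lemma eq_ip_hat u v : (forall a, ip (hat a) u = ip (hat a) v) -> u = v.
Proof.
move=> h; apply/eqP; rewrite -subr_eq0; apply/eqP; apply: ip_eq0 => w.
apply: nr_small_eq0 => e e0.
have c0 : 0 < nr (u - v) + 1 by rewrite ltr_wpDl ?nr_ge0.
have [a ha] := hat_dense w (divr_gt0 e0 c0).
have -> : ip w (u - v) = ip (w - hat a) (u - v).
  by rewrite [RHS]ipBl [ip (hat a) _]ipBr h subrr subr0.
apply: le_trans (cauchy_schwarz _ _) _; rewrite nr_distC.
move: ha; rewrite ler_pdivlMr // => ha; apply: le_trans ha.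
by apply: ler_wpM2l; rewrite ?nr_ge0 // lerDl.
Qed.

Lemma eq_on_hat x y : bounded_operators x -> bounded_operators y ->
  (forall a, x (hat a) = y (hat a)) -> x = y.
Proof.
move=> bx by_ h; rewrite -(adjointK bx) -(adjointK by_); congr adjoint.
apply/funext => u; apply: eq_ip_hat => a.
by rewrite -!adjointP // h.
Qed.

Lemma adjoint_pi a : adjoint (pi a) = pi (star a).
Proof.
apply: eq_on_hat => // [|c]; first exact: bounded_adj.
apply: eq_ip_hat => b; rewrite -adjointP // !pih !hatip.
have -> : star (star a * c) = star c * star (star a) by exact: star_mul.
by rewrite starK mulrA.
Qed.

Lemma pi_rep : star_rep setT 1 *%R (@star R AA) pi.
Proof.
have [lh _ _ _ _] := gns.
split=> //.
- move=> c x y _ _; apply: eq_on_hat => [//||b]; first exact: bounded_lin.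
  by rewrite !fctE !pih mulrDl -scalerAl lh.
- move=> x y _ _; apply: eq_on_hat => [//||b]; first exact: bounded_comp.
  by rewrite /= !pih mulrA.
- by apply: eq_on_hat => [//||b]; [exact: bounded_id | rewrite pih mul1r].
by move=> x _; rewrite -adjoint_pi; exact: adjointP.
Qed.

Lemma pi_norm a : opnorm (pi a) <= nr a.
Proof.
apply: opnorm_le => [|u]; first exact: nr_ge0.
exact: (star_rep_contractive cstar_complete_star_algebra pi_rep).
Qed.

Lemma pi1 : pi 1 = idfun.
Proof. exact: (star_rep_one pi_rep). Qed.

(** The elements a with S (pi a) form a C*-subalgebra of AA, which is closed
    because pi is contractive, and the lam i a generate AA. *)
Lemma pi_in (S : set (H -> H)) : op_cstar_subalgebra S ->
  (forall i a, S (pi (lam i a))) -> forall a, S (pi a).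
Proof.
move=> [Sb [S0 Sl] SM Ss Sc] Slam a.
have [_ gen _] := lam_free.
suff : smallest (@cstar_subalgebra R AA) (\bigcup_i range (lam i)) a.
  move=> /(_ [set b | S (pi b)]); apply; split; last first.
    by move=> _ [i _ [b _ <-]]; exact: Slam.
  split.
  - have -> : (0 : AA) = (-1) *: 1 + 1 by rewrite scaleN1r addNr.
    rewrite /= (star_rep_lin pi_rep) // pi1 scaleN1r addNr; exact: S0.
  - by move=> c x y Sx Sy; rewrite /= (star_rep_lin pi_rep) //; exact: Sl.
  - by move=> x y Sx Sy; rewrite /= (star_rep_mul pi_rep) //; exact: SM.
  - by move=> x Sx; rewrite /= -adjoint_pi; exact: Ss.
  move=> x xS; apply: Sc => // e e0.
  have e0' : 0 < e%:C by rewrite -[0]/(0%:C) ltcR.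
  have [y [Sy]] := xS _ (nbhsx_ballx x e%:C e0').
  rewrite -ball_normE /= nrE ltcR => xy; exists (pi y) => //.
  have -> : pi x - pi y = pi (x - y).
    by rewrite -scaleN1_add -(star_rep_lin pi_rep) // scaleN1r addrC.
  exact: le_lt_trans (pi_norm _) xy.
by rewrite gen.
Qed.

Lemma M_alg_von_neumann : von_neumann_algebra (M_alg pi).
Proof.
have rb : range pi `<=` bounded_operators by move=> _ [a _ <-].
apply: von_neumann_commutant; first exact: commutant_bounded.
apply: commutant_adj => // _ [a _ <-].
by rewrite adjoint_pi; exists (star a).
Qed.

Lemma pi_M_alg a : M_alg pi (pi a).
Proof. by apply: sub_bicommutant => [_ [b _ <-]|] //; exists a. Qed.

Section Symmetries.
Variables (beta : (nat -> nat) -> AA -> AA) (U : (nat -> nat) -> H -> H).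
Hypothesis beta_action : is_index_action lam beta.
Hypothesis U_impl : implements hat beta U.

Let Uu s : finite_perm s -> unitary (U s). Proof. by move=> /U_impl[]. Qed.

Lemma conj_pi s a : finite_perm s -> conj_by (U s) (pi a) = pi (beta s a).
Proof.
move=> fs; have [us Us] := U_impl fs; have bU := unitary_bounded us.
have [[_ _ bM _] _ _] := beta_action fs.
have UE : U s \o pi a = pi (beta s a) \o U s.
  apply: eq_on_hat => [||b]; [exact: bounded_comp | exact: bounded_comp |].
  by rewrite /= Us !pih Us bM.
by rewrite /conj_by UE; apply/funext => u /=; rewrite unitary_adjK.
Qed.

Lemma conj_pi_lam s i a : finite_perm s ->
  conj_by (U s) (pi (lam i a)) = pi (lam (s i) a).
Proof. by move=> fs; rewrite conj_pi //; have [_ _ ->] := beta_action fs. Qed.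

Lemma U_hat1 s : finite_perm s -> U s (hat 1) = hat 1.
Proof.
move=> fs; have [_ Us] := U_impl fs; have [[_ b1 _ _] _ _] := beta_action fs.
by rewrite Us b1.
Qed.

Lemma vector_state_conj s x : finite_perm s ->
  vector_state hat (conj_by (U s) x) = vector_state hat x.
Proof.
move=> fs; have us := Uu fs; have bU := unitary_bounded us.
have U1 : adjoint (U s) (hat 1) = hat 1 by rewrite -{1}(U_hat1 fs) adj_unitaryK.
by rewrite /vector_state /conj_by /= (adjointP bU) U1.
Qed.

Lemma fixed_bounded : fixed_alg pi U `<=` bounded_operators.
Proof. by move=> x [[]]. Qed.

Lemma fixed_id : fixed_alg pi U idfun.
Proof.
split; first by rewrite -pi1; exact: pi_M_alg.
move=> s /Uu us; apply/funext => u; rewrite /conj_by /= unitary_adjK //.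
Qed.

Lemma R_gen_bounded : fixed_alg pi U `|` range pi `<=` bounded_operators.
Proof. by move=> x [/fixed_bounded|[a _ <-]]. Qed.

Lemma R_op_cstar : op_cstar_subalgebra (R_alg pi U).
Proof. exact/Cstar_op_cstar/R_gen_bounded. Qed.

Lemma fixed_R x : fixed_alg pi U x -> R_alg pi U x.
Proof. by move=> Fx; apply: Cstar_gen; left. Qed.

Lemma pi_R a : R_alg pi U (pi a).
Proof. by apply: Cstar_gen; right; exists a. Qed.

Lemma R_id : R_alg pi U idfun.
Proof. by apply: fixed_R; exact: fixed_id. Qed.

Lemma R_bounded : R_alg pi U `<=` bounded_operators.
Proof. by case: R_op_cstar. Qed.

Lemma R_ind (S : set (H -> H)) : op_cstar_subalgebra S ->
  fixed_alg pi U `<=` S -> (forall i a, S (pi (lam i a))) ->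
  R_alg pi U `<=` S.
Proof.
move=> cS FS lS; apply: Cstar_min => // x [/FS //|[a _ <-]].
exact: pi_in.
Qed.

Lemma conj_R s x : finite_perm s -> R_alg pi U x -> R_alg pi U (conj_by (U s) x).
Proof.
move=> fs Rx.
suff [] : [set x | R_alg pi U x /\ R_alg pi U (conj_by (U s) x)] x by [].
move: x Rx; apply: R_ind.
- apply: op_star_rep_preimage R_op_cstar; first exact: R_op_cstar.
    exact: R_id.
  by apply: conj_by_rep; [exact: Uu | exact: R_bounded].
- by move=> x Fx /=; have [_ ->] := Fx => //; split; exact: fixed_R.
- by move=> i a /=; rewrite conj_pi_lam //; split; exact: pi_R.
Qed.

(** Up to e, such an x is a polynomial in elements of F and in finitely many
    pi (lam i a). Comparing representations expresses this without choosing a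
    polynomial. *)
Definition finitely_determined (x : H -> H) : Prop :=
  forall e : R, 0 < e -> exists N, forall Phi Psi : (H -> H) -> H -> H,
    op_star_rep (R_alg pi U) Phi -> op_star_rep (R_alg pi U) Psi ->
    (forall y, fixed_alg pi U y -> Phi y = Psi y) ->
    (forall i a, (i < N)%N -> Phi (pi (lam i a)) = Psi (pi (lam i a))) ->
    forall u, nr (Phi x u - Psi x u) <= e * nr u.

(** Sums, products, adjoints and norm limits only add up errors, because
    representations are contractive; so the finitely determined elements form
    a C*-algebra, and it contains the generators. *)
Lemma R_finitely_determined x : R_alg pi U x -> finitely_determined x.
Proof.
move=> Rx.
have cR := R_op_cstar; have [Rb [R0 Rl] RM Rs Rc] := cR.
have lez (e : R) (u : H) : 0 < e -> 0 <= e * nr u.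
  by move=> e0; rewrite mulr_ge0 ?nr_ge0 // ltW.
have le_maxN N N' i : (i < N)%N -> (i < maxn N N')%N.
  by move=> iN; rewrite leq_max iN.
have le_maxN' N N' i : (i < N')%N -> (i < maxn N N')%N.
  by move=> iN; rewrite leq_max iN orbT.
suff : R_alg pi U `<=` [set x | R_alg pi U x /\ finitely_determined x]
  by move=> /(_ _ Rx)[].
move=> {x Rx}; apply: R_ind; first split.
- by move=> x [/Rb].
- split.
    split=> // e e0; exists 0%N => Phi Psi rPhi rPsi _ _ u.
    by rewrite (op_star_rep0 R_id rPhi) (op_star_rep0 R_id rPsi) subrr nr0 lez.
  move=> c x y [Rx Px] [Ry Py]; split; first exact: Rl.
  move=> e e0; have c0 : 0 < nr c + 1 by rewrite ltr_wpDl ?nr_ge0.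
  have e1 : 0 < e / 2 / (nr c + 1) by rewrite !divr_gt0.
  have e2 : 0 < e / 2 by rewrite divr_gt0.
  have [N hN] := Px _ e1; have [N' hN'] := Py _ e2.
  exists (maxn N N') => Phi Psi rPhi rPsi hF hl u.
  have {}hN := hN _ _ rPhi rPsi hF (fun i a iN => hl i a (le_maxN _ _ _ iN)) u.
  have {}hN' := hN' _ _ rPhi rPsi hF (fun i a iN => hl i a (le_maxN' _ _ _ iN)) u.
  rewrite (star_rep_lin rPhi) // (star_rep_lin rPsi) // !fctE.
  rewrite opprD addrACA -scalerBr.
  apply: le_trans (ler_nrD _ _) _; rewrite nrZ.
  have : nr c * nr (Phi x u - Psi x u) <= e / 2 * nr u.
    apply: le_trans (_ : (nr c + 1) * (e / 2 / (nr c + 1) * nr u) <= _).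
      by rewrite ler_pM ?nr_ge0 // lerDl.
    by rewrite mulrA [_ * (e / 2 / _)]mulrC divfK // gt_eqF.
  lra.
- move=> x y [Rx Px] [Ry Py]; split; first exact: RM.
  move=> e e0; have [bx by_] := (Rb _ Rx, Rb _ Ry).
  have x0 : 0 < opnorm x + 1 by rewrite ltr_wpDl ?opnorm_ge0.
  have y0 : 0 < opnorm y + 1 by rewrite ltr_wpDl ?opnorm_ge0.
  have e1 : 0 < e / 2 / (opnorm y + 1) by rewrite !divr_gt0.
  have e2 : 0 < e / 2 / (opnorm x + 1) by rewrite !divr_gt0.
  have [N hN] := Px _ e1; have [N' hN'] := Py _ e2.
  exists (maxn N N') => Phi Psi rPhi rPsi hF hl u.
  have {}hN := hN _ _ rPhi rPsi hF (fun i a iN => hl i a (le_maxN _ _ _ iN)).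
  have {}hN' := hN' _ _ rPhi rPsi hF (fun i a iN => hl i a (le_maxN' _ _ _ iN)).
  rewrite (star_rep_mul rPhi) // (star_rep_mul rPsi) //=.
  have [_ _ _ PhiB] := bounded_linear (star_rep_bounded rPhi Rx).
  rewrite -(subrKA (Phi x (Psi y u))) -PhiB; apply: le_trans (ler_nrD _ _) _.
  have h1 : nr (Phi x (Phi y u - Psi y u)) <= e / 2 * nr u.
    apply: le_trans (op_star_rep_contractive cR R_id rPhi _ Rx) _.
    apply: le_trans (_ : (opnorm x + 1) * (e / 2 / (opnorm x + 1) * nr u) <= _).
      by rewrite ler_pM ?nr_ge0 ?opnorm_ge0 // lerDl.
    by rewrite mulrA [_ * (e / 2 / _)]mulrC divfK // gt_eqF.
  have h2 : nr (Phi x (Psi y u) - Psi x (Psi y u)) <= e / 2 * nr u.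
    apply: le_trans (hN _) _.
    apply: le_trans (_ : e / 2 / (opnorm y + 1) * ((opnorm y + 1) * nr u) <= _).
      apply: ler_wpM2l; first exact: ltW.
      apply: le_trans (op_star_rep_contractive cR R_id rPsi _ Ry) _.
      by rewrite ler_wpM2r ?nr_ge0 // lerDl.
    by rewrite mulrA divfK // gt_eqF.
  lra.
- move=> x [Rx Px]; split; first exact: Rs.
  move=> e e0; have [N hN] := Px _ e0; exists N => Phi Psi rPhi rPsi hF hl.
  have {}hN := hN _ _ rPhi rPsi hF hl.
  apply: (is_adjoint_bound (T := Phi x - Psi x)) => //; first exact: ltW.
  move=> u v; rewrite !fctE ipBl ipBr.
  by rewrite (star_rep_adj rPhi Rx) (star_rep_adj rPsi Rx).
- move=> x bx h.
  have Rx : R_alg pi U x by apply: Rc => // e /h[y [Ry _] xy]; exists y.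
  split=> // e e0; have e3 : 0 < e / 3 by rewrite divr_gt0.
  have [y [Ry Py] /ltW xy] := h _ e3; have [N hN] := Py _ e3.
  exists N => Phi Psi rPhi rPsi hF hl u.
  have {}hN := hN _ _ rPhi rPsi hF hl u.
  have dist Th : op_star_rep (R_alg pi U) Th ->
      nr (Th x u - Th y u) <= e / 3 * nr u.
    move=> rTh.
    have := op_star_rep_contractive cR R_id rTh u (op_cstarB cR Rx Ry).
    rewrite (op_star_repB rTh) //; move/le_trans; apply.
    by rewrite ler_wpM2r ?nr_ge0.
  have h1 := dist _ rPhi; have := dist _ rPsi; rewrite nr_distC => h2.
  rewrite -(subrKA (Phi y u)); apply: le_trans (ler_nrD _ _) _.
  have := ler_nrD (Phi y u - Psi y u) (Psi y u - Psi x u).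
  rewrite (subrKA (Psi y u)); lra.
- move=> x Fx; split; first exact: fixed_R.
  by move=> e e0; exists 0%N => Phi Psi _ _ hF _ u; rewrite hF // subrr nr0 lez.
move=> i a; split; first exact: pi_R.
by move=> e e0; exists i.+1 => Phi Psi _ _ _ hl u; rewrite hl // subrr nr0 lez.
Qed.

End Symmetries.
End GNSRepresentation.

(** * Finite permutations of the indices *)

Section Permutations.

(** Exchanges the adjacent blocks of indices that start at n and at n + p and
    have lengths p and d, keeping the order inside each block. *)
Definition shift_block (n p d k : nat) : nat :=
  if (k < n)%N then k else
  if (k < n + p)%N then (k + d)%N else
  if (k < n + p + d)%N then (k - p)%N else k.

Lemma shift_blockK n p d : cancel (shift_block n p d) (shift_block n d p).
Proof.
move=> k; rewrite /shift_block.
by case: (ltnP k n) => h1; [rewrite h1 | case: (ltnP k (n + p)) => h2;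
  [|case: (ltnP k (n + p + d)) => h3]]; repeat (case: ifP => ?); lia.
Qed.

Lemma shift_block_finite n p d : finite_perm (shift_block n p d).
Proof.
split; first by exists (shift_block n d p); exact: shift_blockK.
exists (n + p + d)%N => i h; rewrite /shift_block.
by repeat (case: ifP => ?); lia.
Qed.

Lemma shift_block_low n p d i : (i < n)%N -> shift_block n p d i = i.
Proof. by rewrite /shift_block => ->. Qed.

Lemma shift_block_mid n p d i : (i < p)%N ->
  shift_block n p d (n + i) = (n + i + d)%N.
Proof. by move=> h; rewrite /shift_block; repeat (case: ifP => ?); lia. Qed.

(** s, moved to the indices from n on: on generators, conjugating by it after n
    steps of the shift is the same as conjugating by s before them. *)
Definition translate_perm (n : nat) (s : nat -> nat) (k : nat) : nat :=
  if (k < n)%N then k else (n + s (k - n))%N.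

Lemma translate_perm_finite n s :
  finite_perm s -> finite_perm (translate_perm n s).
Proof.
move=> [[t st ts] [N hN]]; split.
  by exists (translate_perm n t) => k; rewrite /translate_perm;
    case: (ltnP k n) => h; rewrite ?h // ltnNge leq_addr /= addKn ?st ?ts subnKC.
exists (n + N)%N => i h; rewrite /translate_perm ltnNge.
by rewrite (leq_trans (leq_addr _ _) h) /= hN; lia.
Qed.

Lemma translate_perm_low n s i : (i < n)%N -> translate_perm n s i = i.
Proof. by rewrite /translate_perm => ->. Qed.

Lemma translate_permD n s i : translate_perm n s (n + i) = (n + s i)%N.
Proof. by rewrite /translate_perm ltnNge leq_addr /= addKn. Qed.

End Permutations.

(** * The limit of the iterates of the shift *)

Section TailLimit.
Context {R : realType} {A AA : cstarAlgType R} {lam : nat -> A -> AA}.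
Hypothesis lam_free : is_free_power lam.
Context {psi : AA -> R[i]} {H : hilbertType R} {hat : AA -> H}
  (pi : AA -> H -> H).
Hypothesis gns : is_GNS hat pi psi.
Context {beta : (nat -> nat) -> AA -> AA}.
Hypothesis beta_action : is_index_action lam beta.
Context {U : (nat -> nat) -> H -> H}.
Hypothesis U_impl : implements hat beta U.

Let Uu s : finite_perm s -> unitary (U s). Proof. by move=> /U_impl[]. Qed.
Let Ub s : finite_perm s -> bounded_operators (U s).
Proof. by move=> fs; exact/unitary_bounded/Uu. Qed.
Let Rb : R_alg pi U `<=` bounded_operators := R_bounded gns (U := U).
Let cR : op_cstar_subalgebra (R_alg pi U) := R_op_cstar gns U.
Let R1 : R_alg pi U idfun := R_id gns U_impl.

Let conj_rep s : finite_perm s -> op_star_rep (R_alg pi U) (conj_by (U s)).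
Proof. by move=> fs; apply: conj_by_rep; [exact: Uu | exact: Rb]. Qed.

Lemma agreeing_reps_eq (Phi Psi : (H -> H) -> H -> H) :
  op_star_rep (R_alg pi U) Phi -> op_star_rep (R_alg pi U) Psi ->
  (forall y, fixed_alg pi U y -> Phi y = Psi y) ->
  (forall i a, Phi (pi (lam i a)) = Psi (pi (lam i a))) ->
  forall x, R_alg pi U x -> Phi x = Psi x.
Proof.
move=> rPhi rPsi hF hl x Rx; apply/funext => u; apply/eqP.
rewrite -subr_eq0; apply/eqP; apply: nr_small_eq0 => e e0.
have c0 : 0 < nr u + 1 by rewrite ltr_wpDl ?nr_ge0.
have [N hN] := R_finitely_determined lam_free gns U_impl Rx (divr_gt0 e0 c0).
apply: le_trans (hN _ _ rPhi rPsi hF (fun i a _ => hl i a) u) _.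
by rewrite mulrAC ler_pdivrMr // ler_wpM2l ?ltW // ltrDl.
Qed.

(** Some hat a is close to u. As hat a = pi a (hat 1), where hat 1 is invariant
    and pi a is determined up to a small error by the generators of small
    index, hat a is almost fixed. *)
Lemma U_almost_fixed u (e : R) : 0 < e -> exists K, forall s, finite_perm s ->
  (forall i, (i < K)%N -> s i = i) -> nr (U s u - u) <= e.
Proof.
move=> e0; have e3 : 0 < e / 3 by rewrite divr_gt0.
have [a ha] := hat_dense gns u e3.
have Ra : R_alg pi U (pi a) by exact: pi_R.
have c0 : 0 < nr (hat 1) + 1 by rewrite ltr_wpDl ?nr_ge0.
have [K hK] := R_finitely_determined lam_free gns U_impl Ra (divr_gt0 e3 c0).
exists K => s fs sK; have uU := Uu fs.
have [_ _ _ UB] := bounded_linear (Ub fs).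
have hF y : fixed_alg pi U y -> conj_by (U s) y = y by case=> _ ->.
have hl i b : (i < K)%N -> conj_by (U s) (pi (lam i b)) = pi (lam i b).
  by move=> /sK iK; rewrite (conj_pi_lam gns beta_action U_impl) // iK.
have := hK _ _ (conj_rep fs) (op_star_rep_id Rb) hF hl (hat 1).
have U1 : adjoint (U s) (hat 1) = hat 1.
  by rewrite -{1}(U_hat1 beta_action U_impl fs) adj_unitaryK.
have [_ _ _ _ pih] := gns.
rewrite /conj_by /= U1 !pih mulr1 => h.
have h1 : nr (U s (hat a) - hat a) <= e / 3.
  apply: le_trans h _; rewrite mulrAC ler_pdivrMr //.
  by rewrite ler_wpM2l ?ltW // ltrDl.
have h2 : nr (U s u - U s (hat a)) = nr (hat a - u).
  by rewrite -UB unitary_norm // nr_distC.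
have -> : U s u - u = (U s u - U s (hat a)) + (U s (hat a) - hat a) + (hat a - u).
  by rewrite !subrKA.
apply: le_trans (ler_nrD _ _) _.
have := ler_nrD (U s u - U s (hat a)) (U s (hat a) - hat a); lra.
Qed.

(** K depends on y only through the bound M, so that one K serves all the
    iterates of the shift at x. *)
Lemma conj_almost_fixed u v (M e : R) : 0 <= M -> 0 < e -> exists K,
  forall s, finite_perm s -> (forall i, (i < K)%N -> s i = i) ->
  forall y, bounded_operators y -> opnorm y <= M ->
    nr (ip (conj_by (U s) y u) v - ip (y u) v) <= e.
Proof.
move=> M0 e0; have e2 : 0 < e / 2 by rewrite divr_gt0.
have cu : 0 < M * nr u + 1 by rewrite ltr_wpDl // mulr_ge0 ?nr_ge0.
have cv : 0 < M * nr v + 1 by rewrite ltr_wpDl // mulr_ge0 ?nr_ge0.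
have [K hK] := U_almost_fixed u (divr_gt0 e2 cv).
have [K' hK'] := U_almost_fixed v (divr_gt0 e2 cu).
exists (maxn K K') => s fs sK y by_ yM; have uU := Uu fs; have bU := Ub fs.
have {}hK : nr (U s u - u) <= e / 2 / (M * nr v + 1).
  by apply: hK => // i iK; apply: sK; rewrite leq_max iK.
have {}hK' : nr (U s v - v) <= e / 2 / (M * nr u + 1).
  by apply: hK' => // i iK; apply: sK; rewrite leq_max iK orbT.
have nU w : nr (U s w) = nr w by exact: unitary_norm.
have [_ _ _ UB] := bounded_linear bU.
have nA w : nr (adjoint (U s) w - w) = nr (U s w - w).
  by rewrite -nU UB unitary_adjK // nr_distC.
rewrite /conj_by /= (adjointP bU).
set u' := adjoint (U s) u; set v' := adjoint (U s) v.
have nv' : nr v' = nr v by rewrite -nU /v' unitary_adjK.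
have [_ _ _ yB] := bounded_linear by_.
have -> : ip (y u') v' - ip (y u) v = ip (y (u' - u)) v' + ip (y u) (v' - v).
  by rewrite yB ipBl ipBr addrA subrK.
apply: le_trans (ler_nrD _ _) _.
have y0 := opnorm_ge0 by_.
have h1 : nr (ip (y (u' - u)) v') <= e / 2.
  apply: le_trans (cauchy_schwarz _ _) _; rewrite nv'.
  apply: le_trans (_ : M * nr (u' - u) * nr v <= _).
    rewrite ler_wpM2r ?nr_ge0 // (le_trans (opnormP _ by_)) //.
    by rewrite ler_wpM2r ?nr_ge0.
  rewrite nA mulrAC; move: hK; rewrite ler_pdivlMr // mulrC; apply: le_trans.
  by rewrite ler_wpM2r ?nr_ge0 // lerDl.
have h2 : nr (ip (y u) (v' - v)) <= e / 2.
  apply: le_trans (cauchy_schwarz _ _) _.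
  apply: le_trans (_ : M * nr u * nr (v' - v) <= _).
    rewrite ler_wpM2r ?nr_ge0 // (le_trans (opnormP _ by_)) //.
    by rewrite ler_wpM2r ?nr_ge0.
  rewrite nA; move: hK'; rewrite ler_pdivlMr // mulrC; apply: le_trans.
  by rewrite ler_wpM2r ?nr_ge0 // lerDl.
lra.
Qed.

Lemma R_sub_M : R_alg pi U `<=` M_alg pi.
Proof.
apply: Cstar_min; first exact/von_neumann_op_cstar/(M_alg_von_neumann gns).
by move=> x [[]//|[a _ <-]]; exact: (pi_M_alg gns).
Qed.

Lemma tail_id : tail_alg lam pi idfun.
Proof.
move=> N _ M [[_ _ <-] _]; split; first exact: bounded_id.
by move=> T _; apply/funext.
Qed.

Let gen N := \bigcup_(i in [set i | (N <= i)%N]) range (pi \o lam i).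

Let gen_bounded N : gen N `<=` bounded_operators.
Proof.
have [_ _ _ pib _] := gns.
by move=> x [i _ [a _ <-]]; exact: pib.
Qed.

(** If s fixes the indices from N on, then U s commutes with pi (lam i a) for
    i >= N, hence with the von Neumann algebra that these generate. *)
Lemma tail_sub_fixed : tail_alg lam pi `<=` fixed_alg pi U.
Proof.
move=> x tx; split.
  apply: (Wstar_min (M_alg_von_neumann gns) _ (tx 0%N I)).
  by move=> _ [i _ [a _ <-]]; exact: (pi_M_alg gns).
move=> s fs; have [N hN] := fs.2; have bU := Ub fs; have uU := Uu fs.
have XN := tx N I.
pose X := [set T | T = U s \/ T = adjoint (U s)].
have Xb : X `<=` bounded_operators.
  by move=> _ [->|->] //; exact: bounded_adj.
have vX : von_neumann_algebra (commutant X).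
  apply: von_neumann_commutant => // _ [->|->]; [by right | left].
  exact: adjointK.
have : commutant X x.
  apply: (Wstar_min vX _ XN) => _ [i /= Ni [a _ <-]].
  have bp : bounded_operators (pi (lam i a)) by case: gns.
  have UE b : U s \o pi (lam i b) = pi (lam i b) \o U s.
    have bpb : bounded_operators (pi (lam i b)) by case: gns.
    by apply/(conj_by_fixed uU bpb);
      rewrite (conj_pi_lam gns beta_action U_impl) // hN.
  split=> // _ [->|->] /=; first by rewrite UE.
  apply/funext => w /=; rewrite -{2}(unitary_adjK uU w).
  have := congr1 (@^~ (adjoint (U s) w)) (UE a) => /= <-.
  by rewrite adj_unitaryK.
move=> [bx /(_ (U s))]; rewrite /X /= => h.
by apply/(conj_by_fixed uU bx); rewrite h //; left.
Qed.

Section Shift.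
Variable alpha : (H -> H) -> (H -> H).
Hypothesis alpha_shift : is_shift lam pi U alpha.

Lemma iter_alpha_fixed n x : fixed_alg pi U x -> iter n alpha x = x.
Proof.
by have [_ _ aF] := alpha_shift; move=> Fx; elim: n => //= n ->; exact: aF.
Qed.

Lemma iter_alpha_lam n i a : iter n alpha (pi (lam i a)) = pi (lam (n + i)%N a).
Proof. by have [_ al _] := alpha_shift; elim: n => //= n ->; exact: al. Qed.

Lemma iter_alpha_R n x : R_alg pi U x -> R_alg pi U (iter n alpha x).
Proof.
by have [[aR _ _ _] _ _] := alpha_shift; elim: n => //= n ih /ih; exact: aR.
Qed.

Lemma iter_alpha_rep n : op_star_rep (R_alg pi U) (iter n alpha).
Proof.
have [[aR al aM aS] _ _] := alpha_shift.
elim: n => [|n ih]; first exact: (op_star_rep_id Rb).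
apply: (op_star_rep_comp (Phi := alpha) (Theta := iter n alpha)) => //.
  by move=> x; exact: iter_alpha_R.
split=> //; first by move=> x /aR /Rb.
  by apply: (iter_alpha_fixed 1); exact: (fixed_id gns U_impl).
by move=> x Rx; rewrite aS //; apply: adjointP; apply: Rb; exact: aR.
Qed.

Lemma iter_alpha_norm n x : R_alg pi U x -> opnorm (iter n alpha x) <= opnorm x.
Proof. exact: (op_star_rep_norm cR R1 (iter_alpha_rep n)). Qed.

Let conj_alpha_rep s n : finite_perm s ->
  op_star_rep (R_alg pi U) (conj_by (U s) \o iter n alpha).
Proof.
move=> fs; apply: op_star_rep_comp; first exact: iter_alpha_R.
  exact: iter_alpha_rep.
exact: conj_rep.
Qed.

Let alpha_conj_rep s n : finite_perm s ->
  op_star_rep (R_alg pi U) (iter n alpha \o conj_by (U s)).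
Proof.
move=> fs; apply: op_star_rep_comp; [|exact: conj_rep|exact: iter_alpha_rep].
by move=> x; exact: (conj_R lam_free gns beta_action U_impl).
Qed.

(** For n <= m, the permutation that moves n + i to m + i for i < N and fixes
    the indices below n turns alpha^n x into alpha^m x up to a small error. As
    it fixes the small indices, it hardly changes the matrix coefficient at
    u and v. *)
Lemma iter_alpha_cauchy x u v (e : R) : R_alg pi U x -> 0 < e ->
  exists K, forall n m, (K <= n)%N -> (K <= m)%N ->
    nr (ip (iter n alpha x u) v - ip (iter m alpha x u) v) <= e.
Proof.
move=> Rx e0; have e2 : 0 < e / 2 by rewrite divr_gt0.
have bx := Rb Rx.
have [K hK] := conj_almost_fixed u v (opnorm_ge0 bx) e2.
have c0 : 0 < nr u * nr v + 1 by rewrite ltr_wpDl ?mulr_ge0 ?nr_ge0.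
have [N hN] := R_finitely_determined lam_free gns U_impl Rx (divr_gt0 e2 c0).
suff le_nm n m : (K <= n)%N -> (n <= m)%N ->
    nr (ip (iter m alpha x u) v - ip (iter n alpha x u) v) <= e.
  exists K => n m Kn Km; case: (leqP n m) => [nm|/ltnW mn]; last exact: le_nm.
  by rewrite nr_distC; exact: le_nm.
move=> Kn nm; pose r := shift_block n N (m - n).
have fr : finite_perm r := shift_block_finite n N (m - n).
have Rn := iter_alpha_R n Rx.
have h1 : nr (ip (conj_by (U r) (iter n alpha x) u) v - ip (iter n alpha x u) v)
    <= e / 2.
  apply: hK => //; [|exact: Rb|exact: iter_alpha_norm].
  by move=> i iK; apply: shift_block_low; exact: leq_trans iK Kn.
have h2 : nr (iter m alpha x u - conj_by (U r) (iter n alpha x) u)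
    <= e / 2 / (nr u * nr v + 1) * nr u.
  apply: (hN _ _ (iter_alpha_rep m) (conj_alpha_rep n fr)).
    move=> y Fy; rewrite iter_alpha_fixed //= iter_alpha_fixed //.
    by case: Fy => _ ->.
  move=> i a iN; rewrite /= !iter_alpha_lam.
  rewrite (conj_pi_lam gns beta_action U_impl) // /r shift_block_mid //.
  by rewrite addnAC subnKC.
have h3 : nr (ip (iter m alpha x u) v - ip (conj_by (U r) (iter n alpha x) u) v)
    <= e / 2.
  rewrite -ipBl; apply: le_trans (cauchy_schwarz _ _) _.
  apply: le_trans (_ : e / 2 / (nr u * nr v + 1) * nr u * nr v <= _).
    by rewrite ler_wpM2r ?nr_ge0.
  rewrite -mulrA mulrAC ler_pdivrMr // ler_wpM2l ?(ltW e2) // lerDl //.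
rewrite -(subrKA (ip (conj_by (U r) (iter n alpha x) u) v)).
apply: le_trans (ler_nrD _ _) _; lra.
Qed.

Lemma iter_alpha_WOT x : R_alg pi U x ->
  exists T, bounded_operators T /\ WOT_cvg (fun n => iter n alpha x) T.
Proof.
move=> Rx; have bx := Rb Rx.
apply: (WOT_complete (opnorm_ge0 bx)).
- by move=> n; case: (Rb (iter_alpha_R n Rx)).
- by move=> n u; exact: (op_star_rep_contractive cR R1 (iter_alpha_rep n) u Rx).
by move=> u v e; exact: iter_alpha_cauchy.
Qed.

Definition alpha_limit (x : H -> H) : H -> H :=
  xget 0 [set T | bounded_operators T /\ WOT_cvg (fun n => iter n alpha x) T].

Local Notation G := alpha_limit.

Lemma alpha_limitP x : R_alg pi U x ->
  bounded_operators (G x) /\ WOT_cvg (fun n => iter n alpha x) (G x).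
Proof. move=> /iter_alpha_WOT; exact: (@xgetPex _ 0
  [set T | bounded_operators T /\ WOT_cvg (fun n => iter n alpha x) T]). Qed.

Lemma alpha_limit_unique x T : R_alg pi U x ->
  WOT_cvg (fun n => iter n alpha x) T -> G x = T.
Proof. by move=> /alpha_limitP[_ h] h'; exact: WOT_unique h h'. Qed.

(** When s fixes the indices from N on, conjugation by U s fixes alpha^n x for
    all n >= N: both sides are representations that agree on generators. *)
Lemma alpha_limit_fixed_alg x : R_alg pi U x -> fixed_alg pi U (G x).
Proof.
move=> Rx; have [bG hG] := alpha_limitP Rx; split.
  apply: (von_neumann_WOT (M_alg_von_neumann gns) _ bG hG).
  by exists 0%N => n _; apply: R_sub_M; exact: iter_alpha_R.
move=> s fs; have [N hN] := fs.2; have uU := Uu fs.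
suff [_ h] : commutant [set U s] (G x) by apply/(conj_by_fixed uU bG); rewrite h.
apply: (commutant_WOT _ _ bG hG); first by move=> _ ->; exact: Ub.
exists N => n Nn; have bn := Rb (iter_alpha_R n Rx); split=> // _ ->.
apply/esym/(conj_by_fixed uU bn).
apply: (agreeing_reps_eq (conj_alpha_rep n fs) (iter_alpha_rep n) _ _ Rx).
  by move=> y Fy /=; rewrite iter_alpha_fixed //; case: Fy => _ ->.
move=> i a /=; rewrite iter_alpha_lam (conj_pi_lam gns beta_action U_impl) //.
by rewrite hN // (leq_trans Nn) // leq_addr.
Qed.

Lemma alpha_limit_id x : fixed_alg pi U x -> G x = x.
Proof.
move=> Fx; apply: alpha_limit_unique; first exact: fixed_R.
apply/WOT_cvgP => u v e e0; exists 0%N => n _.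
by rewrite iter_alpha_fixed // subrr nr0 ltW.
Qed.

Lemma alpha_limit_lin (c : R[i]) x y : R_alg pi U x -> R_alg pi U y ->
  G (c *: x + y) = c *: G x + G y.
Proof.
move=> Rx Ry; have [_ [_ Rl] _ _ _] := cR.
apply: alpha_limit_unique; first exact: Rl.
have -> : (fun n => iter n alpha (c *: x + y)) =
          (fun n => c *: iter n alpha x + iter n alpha y).
  by apply/funext => n; rewrite (star_rep_lin (iter_alpha_rep n)).
by apply: WOT_lin; [case: (alpha_limitP Rx) | case: (alpha_limitP Ry)].
Qed.

Lemma alpha_limit_norm x : R_alg pi U x -> opnorm (G x) <= opnorm x.
Proof.
move=> Rx; have x0 := opnorm_ge0 (Rb Rx); apply: opnorm_le => //.
have [_ hG] := alpha_limitP Rx; apply: (WOT_bounded x0 _ hG) => n u.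
exact: (op_star_rep_contractive cR R1 (iter_alpha_rep n) u Rx).
Qed.

Lemma alpha_limit_alpha x : R_alg pi U x -> G (alpha x) = G x.
Proof.
move=> Rx; apply: alpha_limit_unique; first exact: (iter_alpha_R 1).
have [_ /WOT_cvgP hG] := alpha_limitP Rx; apply/WOT_cvgP => u v e e0.
have [N hN] := hG u v _ e0; exists N => n Nn.
by rewrite -iterSr; apply: hN; exact: leqW.
Qed.

(** Conjugating by U s before alpha^n amounts to conjugating by the translate of
    s after it; the translate fixes the indices below n, so that its effect
    disappears in the limit. *)
Lemma alpha_limit_conj s x : finite_perm s -> R_alg pi U x ->
  G (conj_by (U s) x) = G x.
Proof.
move=> fs Rx; apply: alpha_limit_unique.
  exact: (conj_R lam_free gns beta_action U_impl).
have [_ /WOT_cvgP hG] := alpha_limitP Rx; apply/WOT_cvgP => u v e e0.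
have e2 : 0 < e / 2 by rewrite divr_gt0.
have [N hN] := hG u v _ e2.
have [K hK] := conj_almost_fixed u v (opnorm_ge0 (Rb Rx)) e2.
exists (maxn N K) => n; rewrite geq_max => /andP[/hN h1 Kn].
have ft := translate_perm_finite n fs.
have -> : iter n alpha (conj_by (U s) x) =
          conj_by (U (translate_perm n s)) (iter n alpha x).
  apply: (agreeing_reps_eq (alpha_conj_rep n fs) (conj_alpha_rep n ft) _ _ Rx).
    move=> y Fy /=; rewrite [iter n alpha y]iter_alpha_fixed //.
    by have [_ Fy'] := Fy; rewrite !Fy' // iter_alpha_fixed.
  move=> i a /=; rewrite (conj_pi_lam gns beta_action U_impl) // !iter_alpha_lam.
  by rewrite (conj_pi_lam gns beta_action U_impl) // translate_permD.
have h2 : nr (ip (conj_by (U (translate_perm n s)) (iter n alpha x) u) v -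
              ip (iter n alpha x u) v) <= e / 2.
  apply: hK => //; [|by apply: Rb; exact: iter_alpha_R|exact: iter_alpha_norm].
  by move=> i iK; apply: translate_perm_low; exact: leq_trans iK Kn.
rewrite -(subrKA (ip (iter n alpha x u) v)).
apply: le_trans (ler_nrD _ _) _; lra.
Qed.

(** alpha^n x is close to a conjugate of x by some U r, and conjugation
    preserves the state because U r fixes hat 1. *)
Lemma vector_state_alpha n x : R_alg pi U x ->
  vector_state hat (iter n alpha x) = vector_state hat x.
Proof.
move=> Rx; apply/eqP; rewrite -subr_eq0; apply/eqP; apply: nr_small_eq0 => e e0.
have c0 : 0 < nr (hat 1) * nr (hat 1) + 1 by rewrite ltr_wpDl ?mulr_ge0 ?nr_ge0.
have [N hN] := R_finitely_determined lam_free gns U_impl Rx (divr_gt0 e0 c0).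
pose r := shift_block 0 N n.
have fr : finite_perm r := shift_block_finite 0 N n.
rewrite -(vector_state_conj beta_action U_impl x fr) /vector_state -ipBl.
apply: le_trans (cauchy_schwarz _ _) _.
set k := nr (hat 1).
apply: le_trans (_ : e / (k * k + 1) * k * k <= _).
  apply: ler_wpM2r; first exact: nr_ge0.
  apply: (hN _ _ (iter_alpha_rep n) (conj_rep fr)).
    by move=> y Fy; rewrite iter_alpha_fixed //; case: Fy => _ ->.
  move=> i a iN; rewrite iter_alpha_lam (conj_pi_lam gns beta_action U_impl) //.
  by rewrite -[i in r i]add0n /r shift_block_mid // add0n addnC.
by rewrite -mulrA mulrAC ler_pdivrMr // ler_wpM2l ?(ltW e0) // lerDl.
Qed.

Lemma vector_state_alpha_limit x : R_alg pi U x ->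
  vector_state hat (G x) = vector_state hat x.
Proof.
move=> Rx; have [_ /WOT_cvgP hG] := alpha_limitP Rx.
apply: tends_to_unique (hG _ _) _ => e e0; exists 0%N => n _.
have := vector_state_alpha n Rx; rewrite /vector_state => ->.
by rewrite subrr nr0 ltW.
Qed.

Lemma Q_sub_R : Q_alg lam pi `<=` R_alg pi U.
Proof.
apply: Cstar_min => // x [/tail_sub_fixed/fixed_R//|[a _ <-]]; exact: pi_R.
Qed.

(** alpha^n fixes the tail algebra and maps pi (lam i a) to pi (lam (n + i) a),
    so it maps Q into the von Neumann algebra generated by the indices from n
    on, which is weakly closed. *)
Lemma alpha_limit_tail x : Q_alg lam pi x -> tail_alg lam pi (G x).
Proof.
move=> Qx N _; have Rx := Q_sub_R Qx; have [bG hG] := alpha_limitP Rx.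
have vW := von_neumann_Wstar (gen_bounded (N := N)).
apply: (von_neumann_WOT vW _ bG hG).
exists N => n Nn.
suff [] : [set x | R_alg pi U x /\ Wstar (gen N) (iter n alpha x)] x by [].
apply: Cstar_min Qx.
  apply: (op_star_rep_preimage cR R1 (iter_alpha_rep n)).
  exact: von_neumann_op_cstar.
move=> y [ty|[a _ <-]].
  have Fy := tail_sub_fixed ty; rewrite /= iter_alpha_fixed //.
  by split; [exact: fixed_R | exact: ty].
apply: (pi_in lam_free gns) => [|i b].
  apply: (op_star_rep_preimage cR R1 (iter_alpha_rep n)).
  exact: von_neumann_op_cstar.
split; first exact: pi_R.
rewrite iter_alpha_lam; apply: Wstar_gen; exists (n + i)%N => /=.
  by rewrite (leq_trans Nn) // leq_addr.
by exists b.
Qed.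

(** Applies to R and F as well as to Q and the tail algebra. The norm is 1
    because G is contractive and fixes the identity, whose norm is 1 as
    hat 1 <> 0. *)
Lemma cond_exp_alpha_limit (D E : set (H -> H)) :
  hat 1 <> 0 -> D `<=` R_alg pi U -> E `<=` D -> E `<=` fixed_alg pi U ->
  E idfun -> (forall x, D x -> E (G x)) -> cond_exp D E G.
Proof.
move=> h1 DR ED EF E1 GE; split=> //.
- by move=> c x y /DR Rx /DR Ry; exact: alpha_limit_lin.
- by move=> x /EF; exact: alpha_limit_id.
set S := [set _ | _ in _].
have ubS : ubound S 1.
  by move=> _ [x [/DR Rx x1] <-]; exact: le_trans (alpha_limit_norm Rx) x1.
have n1 : opnorm (idfun : H -> H) <= 1.
  by apply: opnorm_le => // u; rewrite mul1r.
have S1 : S (opnorm (idfun : H -> H)).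
  by exists idfun; [split=> //; exact: ED | rewrite alpha_limit_id //; exact: EF].
have n1' : 1 <= opnorm (idfun : H -> H).
  have h0 : 0 < nr (hat 1).
    rewrite lt_neqAle nr_ge0 eq_sym andbT; apply/eqP => /nr0_eq0; exact: h1.
  have := opnormP (hat 1) (@bounded_id R H).
  by rewrite -[X in X <= _]mul1r ler_pM2r.
apply/eqP; rewrite eq_le; apply/andP; split.
  by apply: sup_le_ub => //; exists (opnorm (idfun : H -> H)).
apply: le_trans n1' _; apply: (sup_upper_bound _ S1).
by split; [exists (opnorm (idfun : H -> H)) | exists 1].
Qed.

End Shift.
End TailLimit.

Theorem theorem5p1p10 (R : realType) (A AA : cstarAlgType R)
    (lam : nat -> A -> AA) (lam_free : is_free_power lam)
    (psi : AA -> R[i]) (psi_state : is_state psi)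
    (psi_sym : is_symmetric lam psi)
    (H : hilbertType R) (hat : AA -> H) (pi : AA -> H -> H)
    (gns : is_GNS hat pi psi)
    (beta : (nat -> nat) -> AA -> AA) (beta_action : is_index_action lam beta)
    (U : (nat -> nat) -> H -> H) (U_impl : implements hat beta U)
    (alpha : (H -> H) -> (H -> H)) (alpha_shift : is_shift lam pi U alpha) :
  exists G : (H -> H) -> (H -> H),
    cond_exp (R_alg pi U) (fixed_alg pi U) G /\
    (forall x, R_alg pi U x -> WOT_cvg (fun n => iter n alpha x) (G x)) /\
    (forall x, R_alg pi U x -> vector_state hat (G x) = vector_state hat x) /\
    (forall x, R_alg pi U x -> G (alpha x) = G x) /\
    (forall s, finite_perm s ->
       forall x, R_alg pi U x -> G (conj_by (U s) x) = G x) /\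
    cond_exp (Q_alg lam pi) (tail_alg lam pi) G.
Proof.
have h1 : hat 1 <> 0.
  move=> h; have [_ _ psi1] := psi_state; have [_ _ hatip _ _] := gns.
  by have /eqP := hatip 1 1; rewrite h ip0l star1 mulr1 psi1 eq_sym oner_eq0.
exists (alpha_limit alpha); split; [|split; [|split; [|split; [|split]]]].
- apply: (cond_exp_alpha_limit lam_free gns beta_action U_impl alpha_shift) => //.
  + by move=> x; exact: fixed_R.
  + exact: (fixed_id gns U_impl).
  + exact: (alpha_limit_fixed_alg lam_free gns beta_action U_impl alpha_shift).
- by move=> x /(alpha_limitP lam_free gns beta_action U_impl alpha_shift)[].
- exact: (vector_state_alpha_limit lam_free gns beta_action U_impl alpha_shift).
- exact: (alpha_limit_alpha lam_free gns beta_action U_impl alpha_shift).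
- move=> s fs x.
  exact: (alpha_limit_conj lam_free gns beta_action U_impl alpha_shift).
apply: (cond_exp_alpha_limit lam_free gns beta_action U_impl alpha_shift) => //.
- exact: (Q_sub_R gns beta_action U_impl).
- by move=> x tx; apply: Cstar_gen; left.
- exact: (tail_sub_fixed gns beta_action U_impl).
- exact: tail_id.
- exact: (alpha_limit_tail lam_free gns beta_action U_impl alpha_shift).
Qed.
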